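(* Let $1\le k\le p$ be integers, let $u_1,\ldots,u_k\in\mathbb{R}^p$ be orthonormal vectors (the axes of a hyper-ellipsoid) and let $s_1\ge s_2\ge\cdots\ge s_k\ge0$ (its semi-axis lengths); put $U=[u_1\ \cdots\ u_k]$ and $S=\operatorname{diag}(s_1,\ldots,s_k)$. Let $c\in\mathbb{R}^p$ and $\Sigma=\operatorname{diag}(\sigma_1^2,\ldots,\sigma_p^2)$ with all $\sigma_i>0$. For $\tau>0$ let $$x_\tau=c+\Lambda^{(\tau)}\eta_\tau+\epsilon,\qquad \epsilon\sim\mathrm{N}_p(0,\Sigma),\qquad \eta_\tau\sim\mathrm{vMF}(e_k,\tau),$$ with $\eta_\tau$ and $\epsilon$ independent, where $\Lambda^{(\tau)}=US^{(\tau)}$, $S^{(\tau)}=\sqrt{\tau}\,\operatorname{diag}(s_1,\ldots,s_{k-1},0)$, and $e_k$ is the $k$-th standard basis vector of $\mathbb{R}^k$. Then, as $\tau\to\infty$, $x_\tau$ converges in distribution to a Gaussian linear factor model with $k-1$ latent factors and loadings matrix $U_{-k}S_{-k}$, where $U_{-k}=[u_1\ \cdots\ u_{k-1}]$ and $S_{-k}=\operatorname{diag}(s_1,\ldots,s_{k-1})$; namely, to $$x_\infty=c+\tilde\Lambda\tilde\eta+\epsilon,\qquad \tilde\eta\sim\mathrm{N}(0,I_{k-1}),\qquad \tilde\Lambda=U_{-k}S_{-k},$$ with $\tilde\eta$ and $\epsilon\sim\mathrm{N}_p(0,\Sigma)$ independent.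
   Context: $\mathcal{S}^{k-1}$ is the unit sphere in $\mathbb{R}^k$ centered at the origin, with uniform probability measure $\mathscr{S}^{k-1}$. The von Mises-Fisher distribution $\mathrm{vMF}(\mu,\tau)$, with $\|\mu\|=1$ and $\tau\ge0$, is the distribution on $\mathcal{S}^{k-1}$ with density proportional to $\exp(\tau\mu^Tz)$ with respect to $\mathscr{S}^{k-1}$. When $k=1$, the term $\tilde\Lambda\tilde\eta$ is understood to be $0$. *)

(* Defs.v *)
From HB Require Import structures.
From mathcomp Require Import all_boot all_order all_algebra.
From mathcomp Require Import all_classical all_reals all_analysis.

Set Implicit Arguments.
Unset Strict Implicit.
Unset Printing Implicit Defensive.

Import Order.TTheory GRing.Theory Num.Theory.
Import numFieldTopology.Exports numFieldNormedType.Exports.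

Local Open Scope classical_set_scope.
Local Open Scope ring_scope.

(* Borel sigma-algebra: generated by the open sets of the library topology. *)
Section borel_matrix.
Variables (R : realType) (m n : nat).
Let open_mx : set (set 'M[R]_(m, n)) := open.

HB.instance Definition _ := @isMeasurable.Build (sigma_display open_mx)
  'M[R]_(m, n) <<s open_mx >> (@sigma_algebra0 _ setT open_mx)
  (@sigma_algebraC _ open_mx) (@sigma_algebra_bigcup _ setT open_mx).

End borel_matrix.

Section euclidean.
Context {R : realType}.

Definition dotv n (x y : 'cV[R]_n) : R := (x^T *m y) 0 0.

(* The Euclidean norm; the library norm `|x| on matrices is the sup norm. *)
Definition enorm n (x : 'cV[R]_n) : R := Num.sqrt (dotv x x).

(* Lebesgue measure on R^n: the image of the product measure on R^(n-1) x R
   under the identification with R^n. *)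
Fixpoint lebesgueV n : set 'cV[R]_n -> \bar R :=
  match n return set 'cV[R]_n -> \bar R with
  | 0 => \d_(0 : 'cV[R]_0)
  | m.+1 => pushforward (lebesgueV (n := m) \x lebesgue_measure)%E
      (fun vx : 'cV[R]_m * measurableTypeR R =>
         col_mx (vx.2 : R)%:M vx.1 : 'cV[R]_m.+1)
  end.

(* Uniform probability on the unit sphere of R^k (0 < k), seen as a measure on
   R^k carried by the sphere: normalized surface area in the sense of polar
   coordinates, i.e. the surface area of A is k times the volume of the cone
   { r z | 0 < r <= 1, z in A, |z| = 1 }; normalizing removes the factor k. *)
Definition sphere_uniform k (A : set 'cV[R]_k) : \bar R :=
  ((fine (lebesgueV [set x : 'cV[R]_k | (enorm x <= 1)%R]))^-1%:E *
   lebesgueV [set x : 'cV[R]_k |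
     (0 < enorm x <= 1)%R /\ A ((enorm x)^-1 *: x)])%E.

Definition vMF_pdf k (mu : 'cV[R]_k) (tau : R) (z : 'cV[R]_k) : R :=
  expR (tau * dotv mu z) /
  fine (\int[@sphere_uniform k]_y (expR (tau * dotv mu y))%:E)%E.

Definition vMF k (mu : 'cV[R]_k) (tau : R) (A : set 'cV[R]_k) : \bar R :=
  (\int[@sphere_uniform k]_(z in A) (vMF_pdf mu tau z)%:E)%E.

(* Nondegenerate case only: Sigma is meant to be positive definite. *)
Definition mvnormal_pdf n (m : 'cV[R]_n) (Sigma : 'M[R]_n) (x : 'cV[R]_n) : R :=
  expR (- (dotv (x - m) (invmx Sigma *m (x - m)) / 2)) /
  Num.sqrt ((2 * pi) ^+ n * \det Sigma).

Definition mvnormal n (m : 'cV[R]_n) (Sigma : 'M[R]_n) (A : set 'cV[R]_n) :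
    \bar R :=
  (\int[@lebesgueV n]_(x in A) (mvnormal_pdf m Sigma x)%:E)%E.

End euclidean.

Section random_vectors.
Context {R : realType}.

Definition has_law d d' (T : measurableType d) (T' : measurableType d')
    (P : probability T R) (X : {RV P >-> T'}) (nu : set T' -> \bar R) : Prop :=
  forall A, measurable A -> distribution P X A = nu A.

Definition independent_RVs d d1 d2 (T : measurableType d)
    (T1 : measurableType d1) (T2 : measurableType d2)
    (P : probability T R) (X : {RV P >-> T1}) (Y : {RV P >-> T2}) : Prop :=
  forall A B, measurable A -> measurable B ->
    P (X @^-1` A `&` Y @^-1` B) = (P (X @^-1` A) * P (Y @^-1` B))%E.

(* Convergence in distribution, as t -> +oo along the reals, of vectors X t
   that may live on different probability spaces. *)
Definition cvg_in_distribution p (d : R -> measure_display)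
    (T : forall t, measurableType (d t)) (P : forall t, probability (T t) R)
    (X : forall t, T t -> 'cV[R]_p)
    (d' : measure_display) (T' : measurableType d') (Q : probability T' R)
    (Y : T' -> 'cV[R]_p) : Prop :=
  forall f : 'cV[R]_p -> R, continuous f -> (exists M, forall x, `|f x| <= M) ->
    ('E_(P t)[f \o X t])%E @[t --> +oo] --> ('E_Q[f \o Y])%E.

End random_vectors.

Section ellipsoid.
Context {R : realType}.

Definition axes_mx p k (u : 'I_k -> 'cV[R]_p) : 'M[R]_(p, k) :=
  \matrix_(i, j) u j i 0.

(* The first k - 1 of k items. *)
Definition all_but_last (T : Type) k (a : 'I_k -> T) (j : 'I_k.-1) : T :=
  a (widen_ord (leq_pred k) j).

Definition last_basis_vector k : 'cV[R]_k := \col_(i < k) (i.+1 == k)%:R.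

Definition S_tau k (s : 'I_k -> R) (tau : R) : 'M[R]_k :=
  Num.sqrt tau *: diag_mx (\row_(i < k) (if i.+1 == k then 0 else s i)).

Definition Lambda_tau p k (u : 'I_k -> 'cV[R]_p) (s : 'I_k -> R) (tau : R) :
    'M[R]_(p, k) :=
  axes_mx u *m S_tau s tau.

(* For k = 1 this is a p x 0 matrix and its product with a vector is 0. *)
Definition Lambda_tilde p k (u : 'I_k -> 'cV[R]_p) (s : 'I_k -> R) :
    'M[R]_(p, k.-1) :=
  axes_mx (all_but_last u) *m diag_mx (\row_(j < k.-1) all_but_last s j).

End ellipsoid.

(* Main.v *)
(* Conditionally on the factor, the noise only replaces the test function f by
   the bounded continuous function h(w) = E f(c + L w + eps), so it suffices to
   show E h(sqrt tau * eta_-) -> E h(N(0, I)), where eta_- drops the last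
   coordinate. In polar coordinates this expectation is a ratio N(h) / N(1),
   where N(h) integrates h(sqrt tau * x_- / |x|) exp(tau * x_k / |x|) over the
   unit ball. After the substitution x = (y / sqrt tau, r), and up to a factor
   that does not depend on h, N(h) has the integrand
     h(y / rho) exp(tau (r / rho - 1)),   rho = sqrt (|y|^2 / tau + r^2) <= 1,
   which is dominated by sup h * exp(- |y|^2 / 2) on -1 <= r <= 1 and converges
   to h(y / r) exp(- |y / r|^2 / 2) if 0 < r < 1 and to 0 if r <= 0 or r > 1.
   Its integral thus converges to a constant times the integral of
   h(w) exp(- |w|^2 / 2); the constant cancels in the ratio, and so does the
   normalization of the Gaussian density, since both laws have mass 1. *)

Require Import Defs.
From HB Require Import structures.
From mathcomp Require Import all_boot all_order all_algebra.
From mathcomp Require Import all_classical all_reals all_analysis.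
From mathcomp Require Import measurable_realfun ring lra.
Import Order.TTheory GRing.Theory Num.Theory.
Import numFieldTopology.Exports numFieldNormedType.Exports.
Local Open Scope classical_set_scope.
Local Open Scope ring_scope.

Set Implicit Arguments.
Unset Strict Implicit.
Unset Printing Implicit Defensive.

(** * Borel sets of matrices *)

Section borel_matrix.
Context {R : realType}.

Lemma measurable_fun_entry m n (i : 'I_m) (j : 'I_n) :
  measurable_fun setT (fun x : 'M[R]_(m, n) => x i j).
Proof.
apply: (measurability _ (RGenOpens.measurableE R)).
move=> _ [_ [a [b ->]] <-]; rewrite setTI; apply: sub_sigma_algebra.
have /continuousP := @coord_continuous R m n i j.
by apply; exact: interval_open.
Qed.

Lemma continuous_measurable_fun_mx m n (f : 'M[R]_(m, n) -> R) :
  continuous f -> measurable_fun setT f.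
Proof.
move=> /continuousP cf; apply: (measurability _ (RGenOpens.measurableE R)).
move=> _ [_ [a [b ->]] <-]; rewrite setTI; apply: sub_sigma_algebra.
by apply: cf; exact: interval_open.
Qed.

(* Open sets are countable unions of balls with rational centers. *)
Lemma measurable_fun_mx d (T : measurableType d) m n (f : T -> 'M[R]_(m, n)) :
  (forall i j, measurable_fun setT (fun x => f x i j)) ->
  measurable_fun setT f.
Proof.
move=> mf.
have mball (q : 'M[R]_(m, n)) (e : R) :
    0 < e -> measurable (f @^-1` (ball q e)).
  move=> e0.
  (* In the sup norm a ball is a product of intervals, so its preimage is a finite intersection over
     the entries. *)
  rewrite (_ : f @^-1` _ = \bigcap_(ij in [set: 'I_m * 'I_n])
      (fun x => f x ij.1 ij.2) @^-1` (ball (q ij.1 ij.2) e)); last first.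
    apply/seteqP; split=> x /=.
      by move=> [_ H] [i j] _ /=; exact: H.
    by move=> H; split=> // i j; exact: (H (i, j)).
  apply: fin_bigcap_measurable => [|[i j] _ /=]; first exact: finite_finset.
  rewrite -[X in measurable X]setTI; apply: mf => //.
  by apply: open_measurable; exact: ball_open.
pose Q (q : 'M[rat]_(m, n)) : 'M[R]_(m, n) := map_mx ratr q.
apply: (measurability (@open [the topologicalType of 'M[R]_(m, n)]) erefl).
move=> _ [U oU <-]; rewrite setTI.
pose I := [set qk : 'M[rat]_(m, n) * nat | ball (Q qk.1) qk.2.+1%:R^-1 `<=` U].
rewrite (_ : _ @^-1` _ =
    \bigcup_(qk in I) (f @^-1` ball (Q qk.1) qk.2.+1%:R^-1)).
  rewrite bigcup_mkcond.
  apply: countable_bigcupT_measurable => [|[q k]]; first exact: countableP.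
  by case: ifPn => _ //; apply: mball; rewrite invr_gt0.
apply/seteqP; split => [x /= Ux|x /= [qk Iqk /= /Iqk]//].
have /nbhs_ballP[e /= e0 eU] : nbhs (f x) U by exact: open_nbhs_nbhs.
(* Half of [e]: a rational center within 1/(k+1) of [f x] gives a ball of that radius that contains
   [f x] and stays in the ball of radius [e]. *)
have [k ke] : exists k, k.+1%:R^-1 < e / 2.
  have [k] := ltr_add_invr (divr_gt0 e0 (ltr0n R 2)).
  by rewrite add0r => ?; exists k.
have qP i j : {q : rat |
    ratr q \in `](f x i j - k.+1%:R^-1), (f x i j + k.+1%:R^-1)[}.
  apply: cid; have [|q qI] :=
    @rat_in_itvoo R (f x i j - k.+1%:R^-1) (f x i j + k.+1%:R^-1).
    by rewrite ltrD2l gtrN// invr_gt0.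
  by exists q.
pose q := \matrix_(i, j) sval (qP i j).
have bx : ball (Q q) k.+1%:R^-1 (f x).
  split => [|i j]; first by rewrite invr_gt0.
  rewrite !mxE; case: (qP i j) => /= r; rewrite in_itv/= /ball /= => /andP[r1 r2].
  by rewrite ltr_distl ltrBlDr; move: r1 r2; rewrite ltrBlDr => -> ->.
exists (q, k) => //= y /= qy; apply: eU.
apply: (@le_ball _ _ _ (k.+1%:R^-1 + k.+1%:R^-1)).
  by rewrite [leRHS](splitr e) lerD ?ltW.
exact: (ball_triangle (ball_sym bx)).
Qed.

End borel_matrix.

(** * Lebesgue measure on column vectors *)

Section lebesgueV_measure.
Context {R : realType}.
Local Open Scope ereal_scope.

Definition consV n (vx : 'cV[R]_n * measurableTypeR R) : 'cV[R]_n.+1 :=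
  col_mx (vx.2 : R)%:M vx.1.

Definition unconsV n (v : 'cV[R]_n.+1) : 'cV[R]_n * measurableTypeR R :=
  (\col_i v (lift ord0 i) 0, v ord0 0)%R.

Lemma consVE0 n (vx : 'cV[R]_n * measurableTypeR R) :
  consV vx ord0 0%R = vx.2.
Proof.
rewrite /consV (_ : ord0 = lshift n (0 : 'I_1)%R); last exact: val_inj.
by rewrite (@col_mxEu _ 1) mxE eqxx mulr1n.
Qed.

Lemma consVE n (vx : 'cV[R]_n * measurableTypeR R) i :
  consV vx (lift ord0 i) 0%R = vx.1 i 0%R.
Proof.
rewrite /consV (_ : lift ord0 i = rshift 1 i); last exact: val_inj.
by rewrite (@col_mxEd _ 1).
Qed.

Lemma consVK n : cancel (@consV n) (@unconsV n).
Proof.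
move=> [v x]; rewrite /unconsV consVE0; congr pair.
by apply/colP => i; rewrite mxE consVE.
Qed.

Lemma measurable_consV n : measurable_fun setT (@consV n).
Proof.
apply: measurable_fun_mx => i j; rewrite [j]ord1.
have [k ->|->] := unliftP ord0 i.
  under eq_fun do rewrite consVE.
  by apply: (measurableT_comp (@measurable_fun_entry R n 1 k 0%R)).
under eq_fun do rewrite consVE0.
exact: measurable_snd.
Qed.

Lemma measurable_unconsV n : measurable_fun setT (@unconsV n).
Proof.
apply: measurable_fun_pair; last exact: measurable_fun_entry.
apply: measurable_fun_mx => i j; under eq_fun do rewrite mxE.
exact: measurable_fun_entry.
Qed.

(* The library's instance on products is shadowed by the one for
   subprobabilities. *)
Lemma sigma_finite_product d d' (T : measurableType d) (T' : measurableType d')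
    (mu : {sigma_finite_measure set T -> \bar R})
    (nu : {sigma_finite_measure set T' -> \bar R}) :
  sigma_finite setT (mu \x nu).
Proof.
have /sigma_finiteP[F [FT ndF mF]] := sigma_finiteT mu.
have /sigma_finiteP[G [GT ndG mG]] := sigma_finiteT nu.
exists (fun n => F n `*` G n); last first.
  move=> n; have [mFn Fn] := mF n; have [mGn Gn] := mG n.
  split; first exact: measurableX.
  by rewrite product_measure1E// lte_mul_pinfty// ge0_fin_numE.
apply/seteqP; split=> // -[x y] _.
have [[i _ Fx] [j _ Gy]] : (\bigcup_i F i) x /\ (\bigcup_i G i) y.
  by rewrite -FT -GT.
exists (maxn i j) => //=; split.
- exact: (subsetPset _ _ (ndF _ _ (leq_maxl i j))).
- exact: (subsetPset _ _ (ndG _ _ (leq_maxr i j))).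
Qed.

(** The sets g^-1(F i) cover because the [F i] do, and their image measure is that of [F i] because
    f^-1(g^-1(F i)) = F i. *)
Lemma sigma_finite_pushforward d d' (T : measurableType d)
    (T' : measurableType d') (mu : set T -> \bar R)
    (f : T -> T') (g : T' -> T) :
  sigma_finite setT mu -> cancel f g -> measurable_fun setT g ->
  sigma_finite setT (pushforward mu f).
Proof.
move=> [F FT mF] fK mg.
exists (fun i => g @^-1` F i).
  by rewrite -preimage_bigcup -FT.
move=> i; have [mFi Fi] := mF i; split.
  by rewrite -[X in measurable X]setTI; exact: mg.
rewrite /pushforward (_ : _ @^-1` _ = F i)//.
by apply/seteqP; split=> x /=; rewrite fK.
Qed.

(* The measure axioms of lebesgueV are proved by induction, so its values are
   first exhibited as those of a bundled measure. *)
Lemma lebesgueV_is_measure n :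
  exists mu : {sigma_finite_measure set 'cV[R]_n -> \bar R},
    mu = lebesgueV (n := n) :> (set 'cV[R]_n -> \bar R).
Proof.
elim: n => [|n [mu muE]].
  by exists (\d_(0%R : 'cV[R]_0))%E.
have sf : sigma_finite setT (pushforward (mu \x lebesgue_measure) (@consV n)).
  apply: (sigma_finite_pushforward _ (@consVK n) (@measurable_unconsV n)).
  exact: sigma_finite_product.
pose nu : {measure set _ -> \bar R} :=
  measure_function_pushforward__canonical__measure_function_Measure
    (mu \x lebesgue_measure) (@measurable_consV n).
pose nuS := Measure_isSigmaFinite.Build _ _ _ nu sf.
pose nuP : {sigma_finite_measure set _ -> \bar R} :=
  HB.pack (nu : set _ -> \bar R) (Measure.class nu) nuS.
by exists nuP; rewrite /= -muE.
Qed.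

Let lebesgueV0 n : lebesgueV (n := n) set0 = 0 :> \bar R.
Proof. by have [mu <-] := lebesgueV_is_measure n; exact: measure0. Qed.

Let lebesgueV_ge0 n A : 0 <= lebesgueV (n := n) A :> \bar R.
Proof. by have [mu <-] := lebesgueV_is_measure n; exact: measure_ge0. Qed.

Let lebesgueV_sigma_additive n :
  semi_sigma_additive (lebesgueV (n := n) : set 'cV[R]_n -> \bar R).
Proof.
by have [mu <-] := lebesgueV_is_measure n; exact: measure_semi_sigma_additive.
Qed.

HB.instance Definition _ n := isMeasure.Build _ _ _
  (lebesgueV (n := n) : set 'cV[R]_n -> \bar R)
  (@lebesgueV0 n) (@lebesgueV_ge0 n) (@lebesgueV_sigma_additive n).

Let lebesgueV_sigma_finite n :
  sigma_finite setT (lebesgueV (n := n) : set 'cV[R]_n -> \bar R).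
Proof.
by have [mu <-] := lebesgueV_is_measure n; exact: sigma_finiteT.
Qed.

HB.instance Definition _ n := Measure_isSigmaFinite.Build _ _ _
  (lebesgueV (n := n) : set 'cV[R]_n -> \bar R) (@lebesgueV_sigma_finite n).

End lebesgueV_measure.

(** * Tonelli and scaling formulas for Lebesgue measure *)

Section lebesgueV_integral.
Context {R : realType}.
Local Open Scope ereal_scope.
Local Notation mu := (@lebesgue_measure R).

(** Uniqueness of Lebesgue measure: [a] times the image of [mu] under x -> a x gives every interval
    ]x, y] its length. *)
Lemma ge0_integral_scale (a : R) (F : measurableTypeR R -> \bar R) :
  (0 < a)%R -> measurable_fun setT F -> (forall x, 0 <= F x) ->
  \int[mu]_x F (a * x)%R = (a^-1)%:E * \int[mu]_x F x.
Proof.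
move=> a0 mF F0.
have ma : measurable_fun setT
    (fun x : measurableTypeR R => (a * x)%R : measurableTypeR R).
  exact: mulrl_measurable.
have ai0 : (0 <= a^-1)%R by rewrite invr_ge0 ltW.
pose am : {measure set (measurableTypeR R) -> \bar R} :=
  measure_function_pushforward__canonical__measure_function_Measure mu ma.
have -> : \int[mu]_x F x = \int[mscale (NngNum (ltW a0)) am]_x F x.
  apply: eq_measure_integral => A mA _.
  apply: lebesgue_measure_unique => // X [[x y] /= _ <-].
  rewrite /mscale/= /pushforward.
  have -> : (fun x0 : R => (a * x0)%R) @^-1` `]x, y] =
      `](x / a)%R, (y / a)%R]%classic.
    apply/seteqP; split=> z /=; rewrite !in_itv/=;
    by rewrite ltr_pdivrMr// ler_pdivlMr// (mulrC z).
  rewrite !lebesgue_measure_itv/= !lte_fin ltr_pM2r ?invr_gt0//.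
  case: ifPn => _; last by rewrite mule0.
  by rewrite -!EFinB -EFinM; congr EFin; field; rewrite gt_eqF.
rewrite ge0_integral_mscale//= ge0_integral_pushforward//= muleA -EFinM.
by rewrite mulVf ?gt_eqF// mul1e.
Qed.

Lemma measurable_fun_integral_cons n (F : 'cV[R]_n.+1 -> \bar R) :
  measurable_fun setT F -> (forall x, 0 <= F x) ->
  measurable_fun setT (fun v => \int[mu]_x F (consV (v, x))).
Proof.
move=> mF F0.
apply: (measurable_fun_fubini_tonelli_F (m2 := mu) (F \o @consV R n)) => //=.
by apply: measurableT_comp => //; exact: measurable_consV.
Qed.

Lemma ge0_integral_lebesgueVS n (F : 'cV[R]_n.+1 -> \bar R) :
  measurable_fun setT F -> (forall x, 0 <= F x) ->
  \int[@lebesgueV R n.+1]_v F v =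
  \int[@lebesgueV R n]_v \int[mu]_x F (consV (v, x)).
Proof.
move=> mF F0.
rewrite (ge0_integral_pushforward (@measurable_consV R n)
  ((@lebesgueV R n \x mu) : {measure set _ -> \bar R}))//=.
rewrite preimage_setT fubini_tonelli1//=.
by apply: measurableT_comp => //; exact: measurable_consV.
Qed.

(** Induction on the dimension: each coordinate that is split off contributes one factor a^-1. *)
Lemma ge0_integral_scaleV n (a : R) (F : 'cV[R]_n -> \bar R) :
  (0 < a)%R -> measurable_fun setT F -> (forall x, 0 <= F x) ->
  \int[@lebesgueV R n]_v F (a *: v)%R =
  (a^-1 ^+ n)%:E * \int[@lebesgueV R n]_v F v.
Proof.
move=> a0; elim: n F => [|n IH] F mF F0.
  rewrite expr0 mul1e; apply: eq_integral => x _.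
  by rewrite [x]flatmx0 scaler0.
have ma m : measurable_fun setT (fun v : 'cV[R]_m => a *: v)%R.
  apply: measurable_fun_mx => i j; under eq_fun do rewrite mxE.
  by apply: measurable_funM => //; exact: measurable_fun_entry.
rewrite ge0_integral_lebesgueVS//; last exact: measurableT_comp.
transitivity (\int[@lebesgueV R n]_v ((a^-1)%:E *
    \int[mu]_x F (consV (a *: v, x)%R))).
  apply: eq_integral => v _.
  rewrite -ge0_integral_scale//.
  - apply: eq_integral => x _; congr F; apply/colP => i.
    have [j ->|->] := unliftP ord0 i; first by rewrite mxE !consVE mxE.
    by rewrite mxE !consVE0.
  - apply: measurableT_comp => //.
    by apply: measurableT_comp (@measurable_consV R n) _; exact: pair1_measurable.
have mI := measurable_fun_integral_cons mF F0.
rewrite ge0_integralZl//=; last 3 first.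
- exact: (measurableT_comp mI (ma n)).
- by move=> x _; apply: integral_ge0.
- by rewrite lee_fin invr_ge0 ltW.
rewrite (IH (fun v => \int[mu]_x F (consV (v, x))))//; last first.
  by move=> v; apply: integral_ge0.
by rewrite muleA -EFinM -exprS -ge0_integral_lebesgueVS.
Qed.

(** [lebesgueV] splits off the first coordinate, whereas the von Mises-Fisher density depends on the
    last one; this map separates the last one. *)
Definition snocV n (vx : 'cV[R]_n * measurableTypeR R) : 'cV[R]_n.+1 :=
  (\col_i oapp (fun j => vx.1 j 0) (vx.2 : R) (unlift ord_max i))%R.

Lemma snocVE_max n (vx : 'cV[R]_n * measurableTypeR R) :
  snocV vx ord_max 0%R = vx.2.
Proof. by rewrite mxE unlift_none. Qed.

Lemma snocVE n (vx : 'cV[R]_n * measurableTypeR R) i :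
  snocV vx (lift ord_max i) 0%R = vx.1 i 0%R.
Proof. by rewrite mxE liftK. Qed.

Lemma measurable_snocV n : measurable_fun setT (@snocV n).
Proof.
apply: measurable_fun_mx => i j; rewrite [j]ord1.
have [k ->|->] := unliftP ord_max i.
  under eq_fun do rewrite snocVE.
  by apply: (measurableT_comp (@measurable_fun_entry R n 1 k 0%R)).
under eq_fun do rewrite snocVE_max.
exact: measurable_snd.
Qed.

Lemma snocV_consV n (v : 'cV[R]_n) (x y : R) :
  snocV (consV (v, x), y) = consV (snocV (v, y), x).
Proof.
apply/colP => i; have [j ->|->] := unliftP ord_max i.
  rewrite snocVE /=; have [k ->|->] := unliftP ord0 j.
    rewrite consVE/= (_ : lift _ _ = lift ord0 (lift ord_max k)).
      by rewrite consVE snocVE.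
    by apply: val_inj; rewrite /= /bump /= !add1n ltnS addnS.
  rewrite consVE0/= (_ : lift _ _ = ord0) ?consVE0//.
  exact: val_inj.
rewrite snocVE_max (_ : ord_max = lift ord0 ord_max) ?consVE ?snocVE_max//.
exact: val_inj.
Qed.

(** Induction: one side splits off the first coordinate and then the last, the other side does the
    reverse, and Tonelli exchanges the two inner integrals. In dimension 1 the first and last
    coordinates coincide. *)
Lemma ge0_integral_snocV n (F : 'cV[R]_n.+1 -> \bar R) :
  measurable_fun setT F -> (forall x, 0 <= F x) ->
  \int[@lebesgueV R n.+1]_v F v =
  \int[@lebesgueV R n]_v \int[mu]_x F (snocV (v, x)).
Proof.
elim: n F => [|n IH] F mF F0.
  rewrite (ge0_integral_lebesgueVS mF F0); apply: eq_integral => v _.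
  apply: eq_integral => x _; congr F; apply/colP => i.
  rewrite (_ : i = ord_max); last by apply: val_inj; case: i => -[].
  rewrite snocVE_max (_ : ord_max = ord0) ?consVE0//; exact: val_inj.
have msnoc k v : measurable_fun setT (fun x : measurableTypeR R => @snocV k (v, x)).
  by apply: measurableT_comp (@measurable_snocV k) _; exact: pair1_measurable.
rewrite (ge0_integral_lebesgueVS mF F0) IH; last 2 first.
- exact: measurable_fun_integral_cons.
- by move=> v; exact: integral_ge0.
rewrite ge0_integral_lebesgueVS; last 2 first.
- apply: (measurable_fun_fubini_tonelli_F (m2 := mu) (F \o @snocV n.+1)) => //=.
  by apply: measurableT_comp => //; exact: measurable_snocV.
- by move=> v; exact: integral_ge0.
apply: eq_integral => v _.
rewrite (fubini_tonelli (m1 := mu) (m2 := mu)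
  (fun xy => F (consV (snocV (v, xy.1), xy.2))))//.
  by apply: eq_integral => x _; apply: eq_integral => y _; rewrite snocV_consV.
apply: measurableT_comp => //.
apply: measurableT_comp; first exact: measurable_consV.
apply: measurable_fun_pair => //=.
exact: (measurableT_comp (msnoc n v)).
Qed.

End lebesgueV_integral.

(** * Densities and the uniform measure on the sphere *)

Section integral_density.
Context d (T : measurableType d) (R : realType).
Variables (mu nu : {measure set T -> \bar R}) (g : T -> R).
Hypotheses (mg : measurable_fun setT g) (g0 : forall x, 0 <= g x).
Hypothesis nuE : forall A, measurable A -> nu A = (\int[mu]_(x in A) (g x)%:E)%E.
Local Open Scope ereal_scope.
Import HBNNSimple.

Let integral_density_nnsfun (h : {nnsfun T >-> R}) :
  \int[nu]_x (h x)%:E = \int[mu]_x ((h x)%:E * (g x)%:E).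
Proof.
under [LHS]eq_integral do rewrite fimfunE -fsumEFin//.
rewrite [LHS]ge0_integral_fsum//; last 2 first.
  - by move=> r; exact/measurable_EFinP/measurableT_comp.
  - by move=> n x _; rewrite EFinM nnfun_muleindic_ge0.
under [RHS]eq_integral.
  move=> x xD; rewrite fimfunE -fsumEFin// ge0_mule_fsuml; last first.
    by move=> r; rewrite EFinM nnfun_muleindic_ge0.
  over.
rewrite [RHS]ge0_integral_fsum//; last 2 first.
  - move=> r; apply: emeasurable_funM; apply/measurable_EFinP => //.
    by apply: measurable_funM => //; exact: measurable_indic.
  - by move=> n x _; rewrite mule_ge0 ?lee_fin// -lee_fin EFinM nnfun_muleindic_ge0.
apply: eq_fsbigr => r _.
(* A negative value has an empty level set, so both sides vanish; for the others the constant can be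
   pulled out of a nonnegative integral. *)
have [r0|r0] := ltP r 0%R.
  by rewrite preimage_nnfun0// !integral0_eq// => x _; rewrite indic0 mulr0 ?mul0e.
rewrite integralZl_indic_nnsfun//= integral_indic// setIT nuE//.
under [RHS]eq_integral do rewrite EFinM -muleA.
rewrite ge0_integralZl//; last 2 first.
- by apply: emeasurable_funM; apply/measurable_EFinP => //; exact: measurable_indic.
- by move=> x _; rewrite mule_ge0// lee_fin.
rewrite [in LHS]integral_mkcond; congr (_ * _); apply: eq_integral => x _.
by rewrite epatch_indic muleC.
Qed.

(** Known for simple functions by linearity, it passes to monotone limits on both sides. *)
Lemma ge0_integral_density (F : T -> \bar R) :
  measurable_fun setT F -> (forall x, 0 <= F x) ->
  \int[nu]_x F x = \int[mu]_x (F x * (g x)%:E).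
Proof.
move=> mF F0; pose f_ := nnsfun_approx measurableT mF.
have Fcvg x : EFin \o f_^~ x @ \oo --> F x.
  by apply: (cvg_nnsfun_approx measurableT mF).
transitivity (limn (fun n => \int[nu]_x (f_ n x)%:E)).
  rewrite -monotone_convergence//=.
  - by apply: eq_integral => x _; apply/esym/cvg_lim => //; exact: Fcvg.
  - by move=> n; exact/measurable_EFinP/measurable_funP.
  - by move=> n x _; rewrite lee_fin.
  - by move=> x _ m n mn; rewrite lee_fin; exact/lefP/nd_nnsfun_approx.
under eq_fun do rewrite integral_density_nnsfun.
rewrite -monotone_convergence//=.
- apply: eq_integral => x _; apply/cvg_lim => //.
  by apply: cvgeZr => //; exact: Fcvg.
- move=> n; apply: emeasurable_funM; apply/measurable_EFinP => //.
- by move=> n x _; rewrite mule_ge0 ?lee_fin.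
- move=> x _ m n mn; rewrite lee_wpmul2r ?lee_fin//.
  exact/lefP/nd_nnsfun_approx.
Qed.

End integral_density.

Lemma measurable_fun_invr (R : realType) : measurable_fun setT (@GRing.inv R).
Proof.
(* The identity also holds at 0, where both sides are 0, and reduces the inverse to a power of a
   nonnegative number. *)
rewrite (_ : GRing.inv = fun x : R => x * (x ^+ 2) `^ (-1)).
  apply: measurable_funM => //.
  apply: (measurableT_comp (measurable_powR _)).
  exact: measurable_funX.
apply/funext => x; rewrite powR_inv1 ?sqr_ge0//.
have [->|x0] := eqVneq x 0; first by rewrite invr0 mul0r.
by field.
Qed.

Section sphere.
Context {R : realType}.
Variable k : nat.
Implicit Types x : 'cV[R]_k.

Lemma dotvE (x y : 'cV[R]_k) : dotv x y = \sum_i x i 0 * y i 0.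
Proof. by rewrite /dotv mxE; apply: eq_bigr => i _; rewrite mxE. Qed.

Lemma measurable_sqnorm : measurable_fun setT (fun x => dotv x x).
Proof.
under eq_fun do rewrite dotvE.
by apply: measurable_sum => i; apply: measurable_funM; exact: measurable_fun_entry.
Qed.

Lemma measurable_enorm : measurable_fun setT (@enorm R k).
Proof.
apply: (measurableT_comp (continuous_measurable_fun (@sqrt_continuous R))).
exact: measurable_sqnorm.
Qed.

(** Since the inverse of 0 is 0, the origin is fixed instead of being sent to the sphere;
    [punctured_ball] leaves it out. *)
Definition normalize x := (enorm x)^-1 *: x.

Lemma measurable_normalize : measurable_fun setT normalize.
Proof.
apply: measurable_fun_mx => i j; under eq_fun do rewrite mxE.
apply: measurable_funM; last exact: measurable_fun_entry.
exact: (measurableT_comp (@measurable_fun_invr R) measurable_enorm).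
Qed.

Definition punctured_ball := [set x : 'cV[R]_k | 0 < enorm x <= 1].

Lemma measurable_punctured_ball : measurable punctured_ball.
Proof.
rewrite (_ : punctured_ball = (@enorm R k) @^-1` `]0, 1]%classic).
  by rewrite -[X in measurable X]setTI; apply: measurable_enorm.
by apply/seteqP; split => x /=; rewrite in_itv.
Qed.

Let cone_factor_ge0 :
  0 <= (fine (@lebesgueV R k [set x | enorm x <= 1]))^-1.
Proof. by rewrite invr_ge0 fine_ge0. Qed.

Let normalized_cone : {measure set 'cV[R]_k -> \bar R} :=
  measure_function_pushforward__canonical__measure_function_Measure
    (mrestr (@lebesgueV R k) measurable_punctured_ball) measurable_normalize.

(** A bundled measure with the values of the set function [sphere_uniform], so that integration
    theorems apply to it. *)
Definition sphere_measure : {measure set 'cV[R]_k -> \bar R} :=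
  mscale (NngNum cone_factor_ge0) normalized_cone.

Lemma sphere_measureE :
  sphere_measure = @sphere_uniform R k :> (set 'cV[R]_k -> \bar R).
Proof.
apply/funext => A; rewrite /= /mscale /= /pushforward /mrestr /sphere_uniform.
congr (_ * lebesgueV _)%E.
by apply/seteqP; split => x /= [].
Qed.

Lemma ge0_integral_sphere (F : 'cV[R]_k -> \bar R) :
  measurable_fun setT F -> (forall x, 0 <= F x)%E ->
  (\int[sphere_measure]_x F x =
   (fine (@lebesgueV R k [set x | enorm x <= 1]))^-1%:E *
   \int[@lebesgueV R k]_(x in punctured_ball) F (normalize x))%E.
Proof.
move=> mF F0.
rewrite ge0_integral_mscale//; congr (_ * _)%E.
rewrite (ge0_integral_pushforward measurable_normalize)// preimage_setT.
have mFn : measurable_fun setT (F \o normalize).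
  exact: (measurableT_comp mF measurable_normalize).
(* Lebesgue measure restricted to the punctured ball has the indicator of that ball as density. *)
rewrite (ge0_integral_density (mu := @lebesgueV R k) (g := \1_punctured_ball))//.
- rewrite [RHS]integral_mkcond; apply: eq_integral => x _.
  by rewrite epatch_indic.
- exact: measurable_indic measurable_punctured_ball.
- move=> A mA; rewrite (integral_indic _ mA measurable_punctured_ball).
  by rewrite /mrestr setIC.
- by move=> x; exact: F0.
Qed.

End sphere.

(** * Laplace asymptotics of the von Mises-Fisher weights *)

Section vMF_asymptotics.
Context {R : realType}.
Variable m : nat.
Local Notation mu := (@lebesgue_measure R).
Implicit Types (y : 'cV[R]_m) (r t : R).

Definition initV (x : 'cV[R]_m.+1) : 'cV[R]_m := \col_i x (lift ord_max i) 0.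

Lemma initV_snocV vx : initV (snocV vx) = vx.1.
Proof. by apply/colP => i; rewrite mxE snocVE. Qed.

Lemma initVZ a x : initV (a *: x) = a *: initV x.
Proof. by apply/colP => i; rewrite !mxE. Qed.

Lemma sqnorm_snocV y r : dotv (snocV (y, r)) (snocV (y, r)) = dotv y y + r ^+ 2.
Proof.
rewrite !dotvE big_ord_recr /= -expr2 snocVE_max.
congr (_ + _); apply: eq_bigr => i _.
rewrite (_ : widen_ord _ i = lift ord_max i) ?snocVE//.
by apply/val_inj; rewrite /= /bump leqNgt ltn_ord.
Qed.

Lemma sqnorm_ge0 n (x : 'cV[R]_n) : 0 <= dotv x x.
Proof. by rewrite dotvE sumr_ge0// => i _; rewrite -expr2 sqr_ge0. Qed.

Lemma sqnormZ n a (x : 'cV[R]_n) : dotv (a *: x) (a *: x) = a ^+ 2 * dotv x x.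
Proof.
by rewrite !dotvE mulr_sumr; apply: eq_bigr => i _; rewrite !mxE; ring.
Qed.

(* (r / rho)^2 = 1 - q / (t rho^2) <= 1 - q / t <= (1 - q / (2 t))^2. *)
Lemma vMF_exponent_le q r t (rho := Num.sqrt (q / t + r ^+ 2)) :
  0 < t -> 0 <= q -> 0 < rho <= 1 -> t * (r / rho - 1) <= - (q / 2).
Proof.
move=> t0 q0 /andP[rho0 rho1].
have s0 : 0 <= q / t + r ^+ 2 by rewrite addr_ge0 ?sqr_ge0// divr_ge0// ltW.
have rhoE : rho ^+ 2 = q / t + r ^+ 2 by rewrite sqr_sqrtr.
have rho21 : rho ^+ 2 <= 1 by rewrite expr_le1// ltW.
have qt0 : 0 <= q / t by rewrite divr_ge0// ltW.
have qt1 : q / t <= 1 by have := sqr_ge0 r; lra.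
suff : r / rho <= 1 - q / t / 2.
  move=> H; have -> : - (q / 2) = t * ((1 - q / t / 2) - 1).
    by field; rewrite gt_eqF.
  by rewrite ler_pM2l// lerB.
apply: (le_trans (ler_norm _)).
rewrite -(@ler_pXn2r _ 2)// ?nnegrE//; last by lra.
rewrite real_normK ?num_real// expr_div_n rhoE.
rewrite ler_pdivrMr -?rhoE ?exprn_gt0// rhoE.
(* With a = q / t the goal amounts to a (1 - rho^2) + a^2 rho^2 / 4 >= 0; this fact and the next
   give the signs of the two terms. *)
have : q / t * (q / t + r ^+ 2) <= q / t * 1 by rewrite ler_wpM2l// -rhoE.
have : 0 <= (q / t) ^+ 2 * (q / t + r ^+ 2) by rewrite mulr_ge0 ?sqr_ge0.
by nra.
Qed.

(** Since q = u (rho^2 - r^2), the expression equals - q / (rho (rho + r)), and rho tends to r. *)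
Lemma vMF_exponent_cvg q r (u : nat -> R) : 0 <= q -> 0 < r ->
  (forall n, 0 < u n) -> u n @[n --> \oo] --> +oo ->
  u n * (r / Num.sqrt (q / u n + r ^+ 2) - 1) @[n --> \oo] -->
    - (q / (2 * r ^+ 2)).
Proof.
move=> q0 r0 u0 uoo.
pose rho n := Num.sqrt (q / u n + r ^+ 2).
have rhoE n : rho n ^+ 2 = q / u n + r ^+ 2.
  by rewrite sqr_sqrtr// addr_ge0 ?sqr_ge0// divr_ge0// ltW.
have rho0 n : 0 < rho n.
  by rewrite sqrtr_gt0 ltr_wpDl ?exprn_gt0// divr_ge0// ltW.
have rhocvg : rho n @[n --> \oo] --> r.
  rewrite -[X in _ --> X](ger0_norm (ltW r0)) -sqrtr_sqr.
  apply: continuous_cvg; first exact: sqrt_continuous.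
  rewrite -[X in _ --> X]add0r -[X in _ --> X + _](mulr0 q).
  apply: cvgD; last exact: cvg_cst.
  by apply: cvgMl_tmp; apply/gtr0_cvgV0 => //; exact: nearW.
rewrite (_ : (fun n => _) =
    (fun n => - (q * (rho n * (rho n + r))^-1))); last first.
  apply/funext => n; rewrite -/(rho n).
  have -> : q = u n * (rho n ^+ 2 - r ^+ 2).
    by rewrite rhoE; field; rewrite gt_eqF.
  field; rewrite ?gt_eqF//=; have := rho0 n; lra.
rewrite (_ : 2 * r ^+ 2 = r * (r + r)); last by ring.
apply: cvgN; apply: cvgMl_tmp; apply: cvgV.
  by rewrite mulf_neq0// gt_eqF// addr_gt0.
by apply: cvgM => //; apply: cvgD => //; exact: cvg_cst.
Qed.

Variables (h : 'cV[R]_m -> R) (M : R).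
Hypotheses (mh : measurable_fun setT h) (h0 : forall y, 0 <= h y).
Hypotheses (hM : forall y, h y <= M).
(** The limit moves the argument of [h] only along a ray, from y / rho to y / r. For the smoothed
    test function this continuity concerns an integral with one real parameter. *)
Hypothesis hc : forall y, continuous (fun a : R => h (a *: y)).

Definition vMF_weight t (z : 'cV[R]_m.+1) : R :=
  h (Num.sqrt t *: initV z) * expR (t * z ord_max 0).

Lemma measurable_vMF_weight t : measurable_fun setT (vMF_weight t).
Proof.
apply: measurable_funM.
  apply: measurableT_comp => //.
  apply: measurable_fun_mx => i j; under eq_fun do rewrite 2!mxE.
  by apply: measurable_funM => //; exact: measurable_fun_entry.
apply: measurableT_comp => //.
by apply: measurable_funM => //; exact: measurable_fun_entry.
Qed.

Lemma vMF_weight_ge0 t z : 0 <= vMF_weight t z.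
Proof. by rewrite mulr_ge0 ?expR_ge0. Qed.

Definition cone_weight t (x : 'cV[R]_m.+1) : R :=
  \1_(@punctured_ball R m.+1) x * vMF_weight t (normalize x).

Lemma measurable_cone_weight t : measurable_fun setT (cone_weight t).
Proof.
apply: measurable_funM.
  exact: measurable_indic (@measurable_punctured_ball R m.+1).
exact: (measurableT_comp (measurable_vMF_weight t) (@measurable_normalize R _)).
Qed.

(** The integrand after the substitution x = (y / sqrt t, r), without its Jacobian. The factor
    exp(-t) lowers the maximum of the exponent to 0. *)
Definition scaled_weight t (z : 'cV[R]_m * measurableTypeR R) : R :=
  expR (- t) * cone_weight t (snocV ((Num.sqrt t)^-1 *: z.1, z.2)).

(** The vector (y / sqrt t, r) has norm rho; after normalization the factor sqrt t inside [h]
    cancels and leaves y / rho. *)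
Lemma scaled_weightE t y r (rho := Num.sqrt (dotv y y / t + r ^+ 2)) : 0 < t ->
  scaled_weight t (y, r) =
  if 0 < rho <= 1 then h (rho^-1 *: y) * expR (t * (r / rho - 1)) else 0.
Proof.
move=> t0; rewrite /scaled_weight /cone_weight/=.
set x := snocV _.
have xE : enorm x = rho.
  rewrite /enorm sqnorm_snocV sqnormZ exprVn sqr_sqrtr ?ltW//.
  by rewrite mulrC.
have -> : \1_(@punctured_ball R m.+1) x = (0 < rho <= 1)%R%:R :> R.
  by rewrite indicE -xE; congr (nat_of_bool _)%:R; apply/idP/idP; rewrite inE.
case: ifPn => _; last by rewrite mul0r mulr0.
rewrite mul1r /vMF_weight /normalize xE initVZ initV_snocV/= !scalerA mxE.
rewrite snocVE_max/= mulrA mulrAC -expRD.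
have st0 : Num.sqrt t != 0 by rewrite gt_eqF// sqrtr_gt0.
rewrite [LHS]mulrC; congr (h (_ *: _) * expR _); last by ring.
by rewrite mulrAC divff// mul1r.
Qed.

Lemma measurable_scaled_weight t : measurable_fun setT (scaled_weight t).
Proof.
apply: measurable_funM => //.
apply: (measurableT_comp (measurable_cone_weight t)).
apply: (measurableT_comp (@measurable_snocV R m)).
apply: measurable_fun_pair => //=.
apply: measurable_fun_mx => i j; under eq_fun do rewrite mxE.
apply: measurable_funM => //.
exact: (measurableT_comp (@measurable_fun_entry R m 1 i j)).
Qed.

Lemma scaled_weight_ge0 t z : 0 <= scaled_weight t z.
Proof. by rewrite !mulr_ge0 ?expR_ge0// vMF_weight_ge0. Qed.

(** On the ball r^2 <= rho^2 <= 1, which confines [r] to [-1, 1], and [vMF_exponent_le] bounds the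
    exponent independently of [t]. *)
Lemma scaled_weight_le t y r : 0 < t ->
  scaled_weight t (y, r) <=
  M * (expR (- (dotv y y / 2)) * \1_(`[-1, 1]%classic : set R) r).
Proof.
move=> t0; rewrite scaled_weightE//; set rho := Num.sqrt _.
have M0 : 0 <= M by exact: le_trans (h0 0) (hM 0).
case: ifPn => [rho01|_]; last by rewrite !mulr_ge0 ?expR_ge0.
have -> : \1_(`[-1, 1]%classic : set R) r = 1 :> R.
  rewrite indicE mem_set//= in_itv/= -ler_norml -(@expr_le1 _ 2)//.
  rewrite real_normK ?num_real//.
  have /andP[rho0 rho1] := rho01.
  have : rho ^+ 2 <= 1 by rewrite expr_le1// ltW.
  have qt : 0 <= dotv y y / t by rewrite divr_ge0 ?sqnorm_ge0// ltW.
  rewrite sqr_sqrtr; last by rewrite addr_ge0// sqr_ge0.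
  by apply: le_trans; rewrite lerDr.
rewrite mulr1 ler_pM ?expR_ge0// ler_expR.
by apply: vMF_exponent_le => //; exact: sqnorm_ge0.
Qed.

Definition limit_weight (z : 'cV[R]_m * measurableTypeR R) : R :=
  \1_(`]0, 1[%classic : set R) z.2 *
  (h ((z.2 : R)^-1 *: z.1) * expR (- (dotv z.1 z.1 / (2 * (z.2 : R) ^+ 2)))).

(** The value r = 1 is excluded: for y = 0 the point then stays on the unit sphere and the weight is
    h(0) for all n, while the limit weight is 0. *)
Lemma scaled_weight_cvg (u : nat -> R) y r :
  (forall n, 0 < u n) -> u n @[n --> \oo] --> +oo -> r != 1 ->
  scaled_weight (u n) (y, r) @[n --> \oo] --> limit_weight (y, r).
Proof.
move=> u0 uoo r1; under eq_cvg do rewrite scaled_weightE//.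
have q0 := sqnorm_ge0 y.
have -> : limit_weight (y, r) = (r \in (`]0, 1[%classic : set R))%:R *
  (h (r^-1 *: y) * expR (- (dotv y y / (2 * r ^+ 2)))).
  by rewrite /limit_weight indicE.
have [r0|r0] := leP r 0.
  have -> : (r \in (`]0, 1[%classic : set R)) = false.
    by apply/negbTE; rewrite notin_setE/= in_itv/= ltNge r0.
  rewrite mul0r.
  have M0 : 0 <= M by exact: le_trans (h0 0) (hM 0).
  (* For r <= 0 the quotient r / rho is at most 0, so the exponent is at most - u n. *)
  apply: (@squeeze_cvgr _ _ _ _ (fun=> 0) (fun n => M * expR (- u n))).
  - apply: nearW => n; case: ifPn => [/andP[rho0 _]|_]; last first.
      by rewrite lexx mulr_ge0 ?expR_ge0.
    rewrite mulr_ge0 ?expR_ge0// ler_pM ?expR_ge0// ler_expR.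
    rewrite -[leRHS]mulrN1 ler_pM2l// lerBlDr addNr.
    by rewrite mulr_le0_ge0// invr_ge0 ltW.
  - exact: cvg_cst.
  - rewrite -[X in _ --> X](mulr0 M); apply: cvgMl_tmp.
    exact: (cvg_comp _ _ uoo (@cvgr_expR R)).
have rhocvg : (dotv y y / u n + r ^+ 2) @[n --> \oo] --> r ^+ 2.
  rewrite -[X in _ --> X]add0r -[X in _ --> X + _](mulr0 (dotv y y)).
  apply: cvgD; last exact: cvg_cst.
  by apply: cvgMl_tmp; apply/gtr0_cvgV0 => //; exact: nearW.
have rho0 n : 0 < Num.sqrt (dotv y y / u n + r ^+ 2).
  by rewrite sqrtr_gt0 ltr_wpDl ?exprn_gt0// divr_ge0// ltW.
have srhocvg : Num.sqrt (dotv y y / u n + r ^+ 2) @[n --> \oo] --> r.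
  rewrite -[X in _ --> X](ger0_norm (ltW r0)) -sqrtr_sqr.
  by apply: continuous_cvg; first exact: sqrt_continuous.
have [rlt1|rge1] := ltP r 1.
  have -> : r \in (`]0, 1[%classic : set R).
    by rewrite mem_set//= in_itv/= r0.
  rewrite mul1r.
  have : h ((Num.sqrt (dotv y y / u n + r ^+ 2))^-1 *: y) *
      expR (u n * (r / Num.sqrt (dotv y y / u n + r ^+ 2) - 1)) @[n --> \oo] -->
      h (r^-1 *: y) * expR (- (dotv y y / (2 * r ^+ 2))).
    apply: cvgM.
      apply: (@cvg_comp _ _ _ (fun n => (Num.sqrt (dotv y y / u n + r ^+ 2))^-1)
        (fun a : R => h (a *: y)) _ (nbhs r^-1)); last exact: hc.
      by apply: cvgV => //; rewrite gt_eqF.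
    apply: continuous_cvg; first exact: continuous_expR.
    exact: vMF_exponent_cvg.
  (* As rho tends to r < 1, the point eventually lies in the ball and the conditional takes its
     first branch. *)
  apply: cvg_trans; apply: near_eq_cvg.
  have : \forall n \near \oo, Num.sqrt (dotv y y / u n + r ^+ 2) < 1.
    exact: (cvgr_lt r srhocvg).
  by apply: filterS => n rho1; rewrite rho0 ltW.
have -> : (r \in (`]0, 1[%classic : set R)) = false.
  by apply/negbTE; rewrite notin_setE/= in_itv/= r0/= ltNge rge1.
rewrite mul0r.
have rgt1 : 1 < r by rewrite lt_neqAle eq_sym r1.
(* For r > 1 also rho > 1, so the weight is 0 for every n. *)
apply: cvg_near_cst; apply: nearW => n; rewrite ifF//.
apply/negP => /andP[_]; apply/negP; rewrite -ltNge.
have r21 : 1 < r ^+ 2 by rewrite exprn_egt1.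
rewrite -[ltLHS]sqrtr1 ltr_sqrt; last first.
  by rewrite ltr_wpDl ?exprn_gt0// divr_ge0// ltW.
by rewrite ltr_wpDl// divr_ge0// ltW.
Qed.

End vMF_asymptotics.

(** * Limits of the weighted integrals by dominated convergence *)

Section vMF_limit.
Context {R : realType}.
Variable m : nat.
Local Notation mu := (@lebesgue_measure R).
Local Notation leb n := (@lebesgueV R n).
Implicit Types (y : 'cV[R]_m) (r t : R).
Local Open Scope ereal_scope.

Definition gauss_weight y : R := expR (- (dotv y y / 2)).

Lemma measurable_gauss_weight : measurable_fun setT gauss_weight.
Proof.
apply: measurableT_comp => //; apply: measurableT_comp => //.
by apply: measurable_funM => //; exact: measurable_sqnorm.
Qed.

Variables (h : 'cV[R]_m -> R) (M : R).
Hypotheses (mh : measurable_fun setT h) (h0 : forall y, (0 <= h y)%R).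
Hypotheses (hM : forall y, (h y <= M)%R).
Hypothesis hc : forall y, continuous (fun a : R => h (a *: y)%R).
(** The Gaussian integral is never computed: [vMF_cvg_gauss] obtains its finiteness from the total
    mass 1 of the limit law. *)
Hypothesis gauss_fin : \int[leb m]_y (gauss_weight y)%:E < +oo.

(** Only the first [m] coordinates are divided by sqrt t, whence the Jacobian sqrt t ^ m. *)
Lemma integral_scaled_weight t : (0 < t)%R ->
  \int[leb m \x mu]_z (scaled_weight h t z)%:E =
  (expR (- t) * Num.sqrt t ^+ m)%:E *
  \int[leb m.+1]_(x in @punctured_ball R m.+1) (vMF_weight h t (normalize x))%:E.
Proof.
move=> t0.
have st0 : (0 < Num.sqrt t)%R by rewrite sqrtr_gt0.
have mc := measurable_cone_weight mh t.
have c0 x : (0 <= cone_weight h t x)%R by rewrite mulr_ge0// vMF_weight_ge0.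
have mEc : measurable_fun setT (EFin \o cone_weight h t) by exact/measurable_EFinP.
pose G y := \int[mu]_r (cone_weight h t (snocV (y, r)))%:E.
have mG : measurable_fun setT G.
  apply: (measurable_fun_fubini_tonelli_F (m2 := mu)
    (fun z => (cone_weight h t (snocV z))%:E)).
    exact: (measurableT_comp mEc (@measurable_snocV R m)).
  by move=> z; rewrite lee_fin.
have G0 y : 0 <= G y by apply: integral_ge0 => r _; rewrite lee_fin.
transitivity ((expR (- t) * Num.sqrt t ^+ m)%:E * \int[leb m]_y G y); last first.
  congr (_ * _); rewrite [RHS]integral_mkcond -(ge0_integral_snocV mEc).
    by apply: eq_integral => x _; rewrite epatch_indic -EFinM mulrC.
  by move=> x; rewrite lee_fin.
rewrite fubini_tonelli1; last 2 first.
- by apply/measurable_EFinP; exact: (measurable_scaled_weight mh).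
- by move=> z; rewrite lee_fin scaled_weight_ge0.
transitivity (\int[leb m]_y ((expR (- t))%:E * G ((Num.sqrt t)^-1 *: y)%R)).
  apply: eq_integral => y _; rewrite /fubini_F /scaled_weight/=.
  under eq_integral do rewrite EFinM.
  rewrite ge0_integralZl//=.
  - apply: (measurableT_comp mEc).
    by apply: (measurableT_comp (@measurable_snocV R m)); exact: pair1_measurable.
  - by move=> r _; rewrite lee_fin.
have mZ : measurable_fun setT (fun y => G ((Num.sqrt t)^-1 *: y)%R).
  apply: (measurableT_comp mG).
  apply: measurable_fun_mx => i j; under eq_fun do rewrite mxE.
  by apply: measurable_funM => //; exact: measurable_fun_entry.
rewrite (ge0_integralZl _ measurableT mZ); last 2 first.
- by move=> y _; exact: G0.
- by rewrite lee_fin expR_ge0.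
have V0 : (0 < (Num.sqrt t)^-1)%R by rewrite invr_gt0.
by rewrite (ge0_integral_scaleV V0 mG G0) invrK muleA EFinM.
Qed.

Lemma scaled_weight_dominated :
  (leb m \x mu).-integrable setT
    (fun z =>
      (M * (gauss_weight z.1 * \1_(`[(-1)%R, 1%R]%classic : set R) z.2))%:E).
Proof.
have M0 : (0 <= M)%R by exact: le_trans (h0 0%R) (hM 0%R).
have mg : measurable_fun setT (fun z : 'cV[R]_m * measurableTypeR R =>
    (M * (gauss_weight z.1 * \1_(`[(-1)%R, 1%R]%classic : set R) z.2))%R).
  apply: measurable_funM => //; apply: measurable_funM.
    exact: (measurableT_comp measurable_gauss_weight).
  exact: (measurableT_comp (measurable_indic (measurable_itv _))).
have g0 z : (0 <= M *
    (gauss_weight z.1 * \1_(`[(-1)%R, 1%R]%classic : set R) z.2))%R.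
  by rewrite !mulr_ge0// expR_ge0.
apply/integrableP; split; first exact/measurable_EFinP.
under eq_integral do rewrite gee0_abs ?lee_fin//.
rewrite fubini_tonelli1; last 2 first.
- exact/measurable_EFinP.
- by move=> z; rewrite lee_fin.
(* The 2 is the length of [-1, 1]; finiteness is thus reduced to [gauss_fin]. *)
rewrite (eq_integral (fun y => (M * 2)%:E * (gauss_weight y)%:E)); last first.
  move=> y _; rewrite /fubini_F/=.
  under eq_integral do rewrite mulrA EFinM.
  rewrite ge0_integralZl//=; last 2 first.
  - apply/measurable_EFinP; exact: measurable_indic (measurable_itv _).
  - by rewrite lee_fin mulr_ge0// expR_ge0.
  rewrite integral_indic// setIT.
  have muE : mu `[(-1)%R, 1%R]%classic = 2%:E.
    rewrite (lebesgue_measure_itv `[(-1)%R, 1%R])/= lte_fin gtrN//.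
    by rewrite -EFinB opprK.
  transitivity ((M * gauss_weight y)%:E * 2%:E).
    by congr (_ * _); exact: muE.
  rewrite -!EFinM.
  by congr EFin; ring.
rewrite ge0_integralZl//=.
- by rewrite lte_mul_pinfty ?lee_fin ?mulr_ge0.
- by apply/measurable_EFinP; exact: measurable_gauss_weight.
- by move=> y _; rewrite lee_fin expR_ge0.
- by rewrite lee_fin mulr_ge0.
Qed.

Lemma measurable_limit_weight : measurable_fun setT (limit_weight h).
Proof.
have mr : measurable_fun setT (fun z : 'cV[R]_m * measurableTypeR R => (z.2 : R)).
  exact: measurable_snd.
have mrV : measurable_fun setT
    (fun z : 'cV[R]_m * measurableTypeR R => (z.2 : R)^-1)%R.
  exact: (measurableT_comp (@measurable_fun_invr R) mr).
apply: measurable_funM.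
  exact: (measurableT_comp (measurable_indic (measurable_itv _)) mr).
apply: measurable_funM.
  apply: (measurableT_comp mh).
  apply: measurable_fun_mx => i j; under eq_fun do rewrite mxE.
  apply: measurable_funM => //.
  exact: (measurableT_comp (@measurable_fun_entry R m 1 i j)).
apply: (measurableT_comp (@measurable_expR R)); apply: measurable_funN.
apply: measurable_funM.
  exact: (measurableT_comp (@measurable_sqnorm R m)).
apply: (measurableT_comp (@measurable_fun_invr R)).
apply: measurable_funM => //; exact: measurable_funX.
Qed.

Lemma limit_weight_ge0 z : (0 <= limit_weight h z)%R.
Proof. by rewrite !mulr_ge0// expR_ge0. Qed.

Lemma cvg_integral_scaled_weight (u : nat -> R) :
  (forall n, 0 < u n)%R -> (u n @[n --> \oo] --> +oo%R) ->
  \int[leb m \x mu]_z (scaled_weight h (u n) z)%:E @[n --> \oo] -->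
    \int[leb m \x mu]_z (limit_weight h z)%:E.
Proof.
move=> u0 uoo.
have mf n : measurable_fun setT (fun z => (scaled_weight h (u n) z)%:E).
  by apply/measurable_EFinP; exact: (measurable_scaled_weight mh).
have ml : measurable_fun setT (fun z => (limit_weight h z)%:E).
  by apply/measurable_EFinP; exact: measurable_limit_weight.
have cvg_ae : {ae leb m \x mu, forall z, setT z ->
    (scaled_weight h (u n) z)%:E @[n --> \oo] --> (limit_weight h z)%:E}.
  (* Convergence can fail only on the hyperplane r = 1, which is null even if the first factor has
     infinite measure, as its product with 0 is 0. *)
  exists (setT `*` [set 1%R]); split.
  - by apply: measurableX.
  - rewrite product_measure1E//.
    transitivity (leb m setT * 0); last by rewrite mule0.
    by congr (_ * _); exact: lebesgue_measure_set1.
  - move=> [y r] /= H; split => //; apply: contrapT => /= /eqP r1; apply: H => _.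
    by apply: cvg_EFin; [exact: nearW|exact: (scaled_weight_cvg h0 hM hc)].
have dom : {ae leb m \x mu, forall z n, setT z ->
    `|(scaled_weight h (u n) z)%:E| <=
    (M * (gauss_weight z.1 * \1_(`[(-1)%R, 1%R]%classic : set R) z.2))%:E}.
  apply: aeW => -[y r] n _; rewrite gee0_abs ?lee_fin ?scaled_weight_ge0//.
  exact: (scaled_weight_le h0 hM).
by have [] := dominated_convergence measurableT mf ml cvg_ae
  scaled_weight_dominated dom.
Qed.

(** The constant that cancels in the ratio. It equals 1 / (m + 1), but the argument uses only that
    it is finite and positive. *)
Definition cone_const : \bar R :=
  \int[mu]_r (\1_(`]0%R, 1%R[%classic : set R) r * r ^+ m)%:E.

(** Integrate over y first: for fixed r in ]0, 1[ the substitution y = r w separates the variables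
    and has Jacobian r^m. *)
Lemma integral_limit_weight :
  \int[leb m \x mu]_z (limit_weight h z)%:E =
  \int[leb m]_y (h y * gauss_weight y)%:E * cone_const.
Proof.
have m1 : measurable_fun setT (\1_(`]0%R, 1%R[%classic : set R) : R -> R).
  exact: measurable_indic (measurable_itv _).
have mhg : measurable_fun setT (fun y => (h y * gauss_weight y)%:E).
  by apply/measurable_EFinP; apply: measurable_funM mh measurable_gauss_weight.
have hg0 y : 0 <= (h y * gauss_weight y)%:E by rewrite lee_fin mulr_ge0// expR_ge0.
rewrite fubini_tonelli2; last 2 first.
- by apply/measurable_EFinP; exact: measurable_limit_weight.
- by move=> z; rewrite lee_fin limit_weight_ge0.
rewrite /cone_const -ge0_integralZl//=; last 3 first.
- apply/measurable_EFinP; apply: measurable_funM => //; exact: measurable_funX.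
- move=> r _; rewrite lee_fin.
  have [r0|r0] := leP 0%R r; first by rewrite mulr_ge0// exprn_ge0.
  rewrite indicE (_ : r \in _ = false) ?mul0r//.
  by apply/negbTE; rewrite notin_setE/= in_itv/= ltNge ltW.
- exact: integral_ge0.
apply: eq_integral => r _; rewrite /fubini_G /limit_weight/= indicE.
have [/set_mem/=|_] := boolP (r \in _); last first.
  by under eq_integral do rewrite mul0r; rewrite integral0 mul0r mule0.
rewrite in_itv/= => /andP[r0 _]; rewrite mul1r.
have ri0 : (0 < r^-1)%R by rewrite invr_gt0.
rewrite muleC -[r in (r ^+ m)%:E]invrK -(ge0_integral_scaleV ri0 mhg)//.
apply: eq_integral => y _; rewrite mul1r /gauss_weight sqnormZ.
by congr (h _ * expR _)%:E; field; rewrite gt_eqF.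
Qed.

Let measurable_cone_fun :
  measurable_fun setT
    (fun r : R => (\1_(`]0%R, 1%R[%classic : set R) r * r ^+ m)%:E).
Proof.
apply/measurable_EFinP; apply: measurable_funM; last exact: measurable_funX.
exact: measurable_indic (measurable_itv _).
Qed.

Let cone_fun_ge0 r : 0 <= (\1_(`]0%R, 1%R[%classic : set R) r * r ^+ m)%:E.
Proof.
rewrite lee_fin indicE; have [/set_mem/=|_] := boolP (r \in _).
  by rewrite in_itv/= => /andP[r0 _]; rewrite mul1r exprn_ge0// ltW.
by rewrite mul0r.
Qed.

Lemma cone_const_fin : cone_const \is a fin_num.
Proof.
rewrite ge0_fin_numE; last by apply: integral_ge0 => r _; exact: cone_fun_ge0.
apply: (@le_lt_trans _ _ (\int[mu]_r (\1_(`]0%R, 1%R[%classic : set R) r)%:E)).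
  apply: ge0_le_integral => //.
  - by apply/measurable_EFinP; exact: measurable_indic (measurable_itv _).
  - move=> r _; rewrite lee_fin indicE.
    have [/set_mem/=|_] := boolP (r \in _); last by rewrite mul0r.
    by rewrite in_itv/= => /andP[r0 r1]; rewrite mul1r exprn_ile1// ltW.
rewrite integral_indic// setIT.
suff : mu `]0%R, 1%R[%classic < +oo by [].
by rewrite (lebesgue_measure_itv `]0%R, 1%R[)/= lte_fin ltr01 oppr0 adde0 ltry.
Qed.

Lemma cone_const_gt0 : 0 < cone_const.
Proof.
(* On this half of the interval r^m >= 2^-m, which bounds the integral below by 2^-m / 2. *)
pose A : set R := `]2^-1%R, 1%R[%classic.
apply: (@lt_le_trans _ _ (\int[mu]_r (2^-1 ^+ m * \1_A r)%:E)).
  under eq_integral do rewrite EFinM.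
  rewrite ge0_integralZl//=.
  - rewrite integral_indic// ?setIT; last exact: measurable_itv.
    have muA : mu A = (2^-1)%:E.
      rewrite (lebesgue_measure_itv `]2^-1%R, 1%R[)/= lte_fin invf_lt1// ltr1n.
      by rewrite -EFinB; congr EFin; field.
    suff : 0 < (2^-1 ^+ m)%:E * mu A by [].
    by rewrite muA lte_fin mulr_gt0 ?exprn_gt0 ?invr_gt0.
  - by apply/measurable_EFinP; exact: measurable_indic (measurable_itv _).
apply: ge0_le_integral => //.
- apply/measurable_EFinP; apply: measurable_funM => //.
  exact: measurable_indic (measurable_itv _).
- move=> r _; rewrite lee_fin [in leLHS]indicE.
  have [/set_mem/=|_] := boolP (r \in A); last first.
    by rewrite mulr0 -lee_fin cone_fun_ge0.
  rewrite /A/= in_itv/= => /andP[r0 r1].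
  have rpos : (0 < r)%R by rewrite (lt_trans _ r0) ?invr_gt0.
  rewrite indicE mem_set/= ?in_itv/= ?rpos// mul1r mulr1.
  by rewrite lerXn2r ?nnegrE ?invr_ge0// ltW.
Qed.

Lemma cvg_integral_vMF_weight (u : nat -> R) :
  (forall n, 0 < u n)%R -> (u n @[n --> \oo] --> +oo%R) ->
  (expR (- u n) * Num.sqrt (u n) ^+ m)%:E *
    \int[leb m.+1]_(x in @punctured_ball R m.+1)
      (vMF_weight h (u n) (normalize x))%:E @[n --> \oo] -->
  \int[leb m]_y (h y * gauss_weight y)%:E * cone_const.
Proof.
move=> u0 uoo; rewrite -integral_limit_weight.
under eq_cvg do rewrite -(integral_scaled_weight (u0 _)).
exact: cvg_integral_scaled_weight.
Qed.

End vMF_limit.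

(** * Laws and weak convergence *)

Section laws.
Context {R : realType}.
Local Open Scope ereal_scope.

(** This exchanges noise variables that live on different probability spaces but have the same
    law. *)
Lemma eq_integral_law d1 d2 d (T1 : measurableType d1) (T2 : measurableType d2)
    (T : measurableType d) (P1 : probability T1 R) (P2 : probability T2 R)
    (X1 : {RV P1 >-> T}) (X2 : {RV P2 >-> T}) (nu : set T -> \bar R)
    (F : T -> \bar R) :
  has_law X1 nu -> has_law X2 nu ->
  \int[distribution P1 X1]_x F x = \int[distribution P2 X2]_x F x.
Proof.
move=> X1nu X2nu; apply: eq_measure_integral => A mA _.
exact: etrans (X1nu A mA) (esym (X2nu A mA)).
Qed.

(** By independence the joint law agrees with the product of the marginals on rectangles, hence
    everywhere; Tonelli does the rest. *)
Lemma ge0_integral_independent d d1 d2 (T : measurableType d)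
    (T1 : measurableType d1) (T2 : measurableType d2) (P : probability T R)
    (X : {RV P >-> T1}) (Y : {RV P >-> T2}) (F : T1 * T2 -> \bar R) :
  independent_RVs X Y -> measurable_fun setT F -> (forall z, 0 <= F z) ->
  \int[P]_w F (X w, Y w) =
  \int[distribution P X]_x \int[distribution P Y]_y F (x, y).
Proof.
move=> XY mF F0.
have mXY : measurable_fun setT (fun w => (X w, Y w)).
  by apply: measurable_fun_pair => //; exact: measurable_funPT.
pose XYP : {measure set _ -> \bar R} :=
  measure_function_pushforward__canonical__measure_function_Measure P mXY.
have XYE A : measurable A -> (distribution P X \x distribution P Y) A = XYP A.
  apply: product_measure_unique => B C mB mC.
  by rewrite /XYP/= /pushforward -XY.
rewrite -[RHS](@fubini_tonelli1 _ _ _ _ _ (distribution P X)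
  (distribution P Y) F)//.
rewrite (eq_measure_integral XYP) => [|A mA _]; last exact: XYE.
by rewrite (ge0_integral_pushforward mXY)// preimage_setT.
Qed.

(** For infinite [x] the product could only be 0 or infinite. *)
Lemma normalized_fin_num (a : R) (x : \bar R) :
  (0 <= a)%R -> 0 <= x -> a%:E * x = 1 -> x \is a fin_num.
Proof.
move=> a0; case: x => [//|_|//].
have [->|a1] := eqVneq a 0%R.
  by rewrite mul0e => /eqP; rewrite eqe eq_sym oner_eq0.
by rewrite gt0_muley// lte_fin lt_neqAle eq_sym a1.
Qed.

Section vMF.
Variables (m : nat) (tau : R).
Variables (d : measure_display) (T : measurableType d) (P : probability T R).
Variable X : {RV P >-> 'cV[R]_m.+1}.
Hypothesis Xlaw : has_law X (vMF (last_basis_vector m.+1) tau).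

Lemma dotv_last_basis_vector (z : 'cV[R]_m.+1) :
  dotv (last_basis_vector m.+1) z = z ord_max 0%R.
Proof.
rewrite dotvE (bigD1 ord_max)//= mxE eqxx mul1r big1 ?addr0// => i im.
by rewrite mxE eqSS (_ : (nat_of_ord i == m) = false) ?mul0r//; exact: negbTE.
Qed.

(** The constant collects the normalizations of the sphere and of the density. It need not be known:
    taking F = 1 determines it, as the law has mass 1. *)
Lemma vMF_integral : exists2 a : R, (0 <= a)%R &
  forall F : 'cV[R]_m.+1 -> R, measurable_fun setT F -> (forall z, 0 <= F z)%R ->
  \int[distribution P X]_z (F z)%:E =
  a%:E * \int[@lebesgueV R m.+1]_(x in @punctured_ball R m.+1)
    (F (normalize x) * expR (tau * normalize x ord_max 0))%:E.
Proof.
pose g := vMF_pdf (last_basis_vector m.+1) tau.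
pose Z := fine (\int[@sphere_uniform R m.+1]_y
  (expR (tau * dotv (last_basis_vector m.+1) y))%:E).
have Z0 : (0 <= Z^-1)%R.
  rewrite invr_ge0 fine_ge0//; rewrite -sphere_measureE.
  by apply: integral_ge0 => y _; rewrite lee_fin expR_ge0.
pose V := fine (@lebesgueV R m.+1 [set x : 'cV[R]_m.+1 | (enorm x <= 1)%R]).
have V0 : (0 <= V^-1)%R by rewrite invr_ge0 fine_ge0.
exists (V^-1 * Z^-1)%R => [|F mF F0]; first exact: mulr_ge0.
have gE z : g z = (Z^-1 * expR (tau * z ord_max 0))%R.
  by rewrite /g /vMF_pdf dotv_last_basis_vector mulrC.
have me : measurable_fun setT (fun z : 'cV[R]_m.+1 => expR (tau * z ord_max 0%R)).
  apply: measurableT_comp => //; apply: measurable_funM => //.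
  exact: measurable_fun_entry.
have mg : measurable_fun setT g.
  rewrite (_ : g = fun z => Z^-1 * expR (tau * z ord_max 0))%R; last exact/funext.
  exact: measurable_funM.
have g0 z : (0 <= g z)%R by rewrite gE mulr_ge0 ?expR_ge0.
rewrite (ge0_integral_density (mu := sphere_measure m.+1) mg g0); last 3 first.
- by move=> A mA; rewrite sphere_measureE; exact: Xlaw.
- exact/measurable_EFinP.
- by move=> z; rewrite lee_fin.
have mFg : measurable_fun setT (fun z => (F z)%:E * (g z)%:E).
  by apply: emeasurable_funM; exact/measurable_EFinP.
rewrite (ge0_integral_sphere mFg); last first.
  by move=> z; rewrite mule_ge0// lee_fin.
rewrite EFinM -muleA; congr (_ * _).
rewrite -ge0_integralZl//; last 3 first.
- exact: measurable_punctured_ball.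
- apply/measurable_EFinP; apply: measurable_funTS; apply: measurable_funM.
    exact: (measurableT_comp mF (@measurable_normalize R _)).
  exact: (measurableT_comp me (@measurable_normalize R _)).
- by move=> x _; rewrite lee_fin mulr_ge0// expR_ge0.
by apply: eq_integral => x _; rewrite gE -!EFinM; congr EFin; ring.
Qed.

End vMF.

Section gauss.
Variables (m : nat).
Variables (d : measure_display) (T : measurableType d) (P : probability T R).
Variable X : {RV P >-> 'cV[R]_m}.
Hypothesis Xlaw : has_law X (mvnormal 0%R 1%:M%R).

Lemma gauss_integral : exists2 a : R, (0 <= a)%R &
  forall F : 'cV[R]_m -> R, measurable_fun setT F -> (forall z, 0 <= F z)%R ->
  \int[distribution P X]_z (F z)%:E =
  a%:E * \int[@lebesgueV R m]_y (F y * gauss_weight y)%:E.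
Proof.
pose g : 'cV[R]_m -> R := mvnormal_pdf 0%R 1%:M%R.
pose a : R := (Num.sqrt ((2 * pi) ^+ m * \det (1%:M : 'M[R]_m)))^-1%R.
have a0 : (0 <= a)%R by rewrite invr_ge0 sqrtr_ge0.
exists a => // F mF F0.
have gE y : g y = (a * gauss_weight y)%R.
  by rewrite /g /mvnormal_pdf subr0 invmx1 mul1mx mulrC.
have mg : measurable_fun setT g.
  rewrite (_ : g = fun z => a * gauss_weight z)%R; last exact/funext.
  by apply: measurable_funM => //; exact: measurable_gauss_weight.
have g0 z : (0 <= g z)%R by rewrite gE mulr_ge0 ?expR_ge0.
rewrite (ge0_integral_density (mu := @lebesgueV R m) mg g0); last 3 first.
- by move=> A mA; exact: Xlaw.
- exact/measurable_EFinP.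
- by move=> z; rewrite lee_fin.
rewrite -ge0_integralZl//; last 2 first.
- apply/measurable_EFinP; apply: measurable_funM => //.
  exact: measurable_gauss_weight.
- by move=> x _; rewrite lee_fin mulr_ge0// expR_ge0.
by apply: eq_integral => x _; rewrite gE -!EFinM; congr EFin; ring.
Qed.

End gauss.

End laws.

Section weak_convergence.
Context {R : realType}.
Local Open Scope ereal_scope.

(** Normalization forces a = 1 / N1, and any [c] > 0 may be inserted in both terms of the quotient.
    Here [c] will be exp(-t) sqrt t ^ m for the sphere and [cone_const] for the Gaussian. *)
Lemma normalized_ratio (a c : R) (x N1 N2 : \bar R) :
  (0 <= a)%R -> (0 < c)%R -> 0 <= N1 -> 0 <= N2 -> x \is a fin_num ->
  a%:E * N1 = 1 -> x = a%:E * N2 ->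
  [/\ N1 \is a fin_num, N2 \is a fin_num, fine N1 != 0%R &
    x = (fine (c%:E * N2) / fine (c%:E * N1))%:E].
Proof.
move=> a0 c0 N10 N20 xfin aN1 xE.
have N1fin := normalized_fin_num a0 N10 aN1.
move: N1fin aN1 N10; case: N1 => // n1 _; rewrite -EFinM => -[an1] _.
have agt0 : (0 < a)%R.
  rewrite lt_neqAle a0 andbT; apply/eqP => a0'.
  by move: an1; rewrite -a0' mul0r => /eqP; rewrite eq_sym oner_eq0.
have n10 : n1 != 0%R.
  apply/eqP => n10; move: an1.
  by rewrite n10 mulr0 => /eqP; rewrite eq_sym oner_eq0.
move: xE N20; case: N2 => [n2 xE _|xE|//]; last first.
  by move: xfin; rewrite xE gt0_muley.
split => //; rewrite xE -!EFinM/=; congr EFin.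
have -> : a = n1^-1%R by rewrite -[LHS](mulfK n10) an1 mul1r.
by field; rewrite n10 gt_eqF.
Qed.

Lemma ge0_bounded_integral_fin_num d (T : measurableType d)
    (P : probability T R) (f : T -> R) (M : R) :
  measurable_fun setT f -> (forall x, 0 <= f x)%R -> (forall x, f x <= M)%R ->
  \int[P]_x (f x)%:E \is a fin_num.
Proof.
move=> mf f0 fM.
rewrite ge0_fin_numE; last by apply: integral_ge0 => x _; rewrite lee_fin.
apply: (@le_lt_trans _ _ (\int[P]_x (cst M%:E) x)).
  apply: ge0_le_integral => //.
  - by move=> x _; rewrite lee_fin.
  - exact/measurable_EFinP.
  - by move=> x _; rewrite lee_fin.
by rewrite integral_cst//= probability_setT mule1 ltry.
Qed.

Lemma integral_probability_cst1 d (T : measurableType d) (P : probability T R) :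
  \int[P]_x 1%:E = 1.
Proof. by rewrite (integral_cst P measurableT)/= probability_setT mul1e. Qed.

(** Both sides are ratios of the integral with [h] to the integral with the constant 1, so numerator
    and denominator are two instances of one limit. *)
Lemma vMF_cvg_gauss m (h : 'cV[R]_m -> R) (M : R)
    (d : nat -> measure_display) (T : forall n, measurableType (d n))
    (P : forall n, probability (T n) R)
    (X : forall n, {RV (P n) >-> 'cV[R]_m.+1}) (u : nat -> R)
    (d' : measure_display) (T' : measurableType d') (Q : probability T' R)
    (Y : {RV Q >-> 'cV[R]_m}) :
  measurable_fun setT h -> (forall y, 0 <= h y)%R -> (forall y, h y <= M)%R ->
  (forall y, continuous (fun a : R => h (a *: y)%R)) ->
  (forall n, 0 < u n)%R -> (u n @[n --> \oo] --> +oo%R) ->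
  (forall n, has_law (X n) (vMF (last_basis_vector m.+1) (u n))) ->
  has_law Y (mvnormal 0%R 1%:M%R) ->
  \int[distribution (P n) (X n)]_z (h (Num.sqrt (u n) *: initV z)%R)%:E
    @[n --> \oo] --> \int[distribution Q Y]_y (h y)%:E.
Proof.
move=> mh h0 hM hc u0 uoo Xlaw Ylaw.
pose one : 'cV[R]_m -> R := fun=> 1%R.
have m1 : measurable_fun setT one by exact: measurable_cst.
have one0 y : (0 <= one y)%R by rewrite ler01.
have onec (y : 'cV[R]_m) : continuous (fun a : R => one (a *: y)%R).
  by move=> a; exact: cvg_cst.
have J0 (k : 'cV[R]_m -> R) : (forall y, 0 <= k y)%R ->
    0 <= \int[@lebesgueV R m]_y (k y * gauss_weight y)%:E.
  by move=> k0; apply: integral_ge0 => y _; rewrite lee_fin mulr_ge0// expR_ge0.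
have [b b0 bE] := gauss_integral Ylaw.
have bJ1 : b%:E * \int[@lebesgueV R m]_y (one y * gauss_weight y)%:E = 1.
  by rewrite -bE//; exact: (integral_probability_cst1 (distribution Q Y)).
have C0 : (0 < fine (@cone_const R m))%R.
  by rewrite fine_gt0// cone_const_gt0 ltey_eq cone_const_fin.
have Efin : \int[distribution Q Y]_y (h y)%:E \is a fin_num.
  exact: (@ge0_bounded_integral_fin_num _ _ (distribution Q Y) _ M).
have [J1fin Jhfin J1n0 EE] :=
  normalized_ratio b0 C0 (J0 _ one0) (J0 _ h0) Efin bJ1 (bE _ mh h0).
(* The denominator of the Gaussian ratio is finite because it is normalized to 1 by [b]. *)
have gfin : \int[@lebesgueV R m]_y (gauss_weight y)%:E < +oo.
  rewrite -ge0_fin_numE; last first.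
    by apply: integral_ge0 => y _; rewrite lee_fin expR_ge0.
  move: J1fin; congr (_ \is a fin_num).
  by apply: eq_integral => y _; rewrite mul1r.
have CE := fineK (@cone_const_fin R m).
pose N (k : 'cV[R]_m -> R) n :=
  \int[@lebesgueV R m.+1]_(x in @punctured_ball R m.+1)
      (vMF_weight k (u n) (normalize x))%:E.
have N0 k n : (forall y, 0 <= k y)%R -> 0 <= N k n.
  by move=> k0; apply: integral_ge0 => x _; rewrite lee_fin vMF_weight_ge0.
pose c n : R := (expR (- u n) * Num.sqrt (u n) ^+ m)%R.
have c0 n : (0 < c n)%R by rewrite mulr_gt0 ?expR_gt0// exprn_gt0// sqrtr_gt0.
have mZ n (k : 'cV[R]_m -> R) : measurable_fun setT k ->
    measurable_fun setT (fun z : 'cV[R]_m.+1 => k (Num.sqrt (u n) *: initV z)%R).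
  move=> mk.
  have mg : measurable_fun setT
      (fun z : 'cV[R]_m.+1 => Num.sqrt (u n) *: initV z)%R.
    apply: measurable_fun_mx => i j; under eq_fun do rewrite 2!mxE.
    by apply: measurable_funM => //; exact: measurable_fun_entry.
  exact: (measurableT_comp mk mg).
have ratioE n :
    \int[distribution (P n) (X n)]_z (h (Num.sqrt (u n) *: initV z)%R)%:E =
    (fine ((c n)%:E * N h n) / fine ((c n)%:E * N one n))%:E.
  have [a a0 aE] := vMF_integral (Xlaw n).
  have aN1 : a%:E * N one n = 1.
    rewrite -(aE (fun z => one (Num.sqrt (u n) *: initV z)))//.
    exact: (integral_probability_cst1 (distribution (P n) (X n))).
  have fin := @ge0_bounded_integral_fin_num _ _ (distribution (P n) (X n)) _ M
    (mZ n _ mh) (fun _ => h0 _) (fun _ => hM _).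
  by have [] := normalized_ratio a0 (c0 n) (N0 _ _ one0) (N0 _ _ h0) fin aN1
    (aE _ (mZ n _ mh) (fun _ => h0 _)).
under eq_cvg do rewrite ratioE.
rewrite EE; apply: cvg_EFin; first exact: nearW.
have lim (k : 'cV[R]_m -> R) B : measurable_fun setT k -> (forall y, 0 <= k y)%R ->
    (forall y, k y <= B)%R -> (forall y, continuous (fun a : R => k (a *: y)%R)) ->
    \int[@lebesgueV R m]_y (k y * gauss_weight y)%:E \is a fin_num ->
    fine ((c n)%:E * N k n) @[n --> \oo] -->
    fine ((fine (@cone_const R m))%:E *
      \int[@lebesgueV R m]_y (k y * gauss_weight y)%:E).
  move=> mk k0 kB kc kfin; apply: fine_cvg.
  rewrite CE fineK; last by rewrite fin_numM// cone_const_fin.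
  by rewrite muleC; exact: (cvg_integral_vMF_weight mk k0 kB kc gfin u0 uoo).
apply: cvgM; first exact: (lim h M).
apply: cvgV; last exact: (lim one 1%R).
by rewrite fineM// mulf_neq0// gt_eqF.
Qed.

End weak_convergence.

(** * Factor models and integration over the noise *)

Section factor_model.
Context {R : realType}.
Variables (p : nat).
Local Open Scope ereal_scope.

Lemma measurable_affine k (A : 'M[R]_(p, k)) (c : 'cV[R]_p) :
  measurable_fun setT
    (fun ze : 'cV[R]_k * 'cV[R]_p => c + A *m ze.1 + ze.2)%R.
Proof.
apply: measurable_fun_mx => i j.
under eq_fun do rewrite 3!mxE.
apply: measurable_funD; last first.
  exact: (measurableT_comp (@measurable_fun_entry R p 1 i j)).
apply: measurable_funD => //; apply: measurable_sum => l.
apply: measurable_funM => //.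
exact: (measurableT_comp (@measurable_fun_entry R k 1 l j)).
Qed.

(** The zero in the last diagonal entry of [S_tau] removes the last axis and the last coordinate;
    sqrt tau is then moved from the loadings to the factor. *)
Lemma Lambda_tau_mul m (u : 'I_m.+1 -> 'cV[R]_p) (s : 'I_m.+1 -> R) (tau : R)
    (z : 'cV[R]_m.+1) :
  Lambda_tau u s tau *m z = Lambda_tilde u s *m (Num.sqrt tau *: initV z)%R.
Proof.
rewrite /Lambda_tau /Lambda_tilde /S_tau -!mulmxA -scalemxAl -scalemxAr.
rewrite -[in RHS]scalemxAr -[in RHS]scalemxAr; congr (_ *: _)%R.
apply/colP => i; rewrite !mxE big_ord_recr/=.
rewrite [X in (_ + X)%R](_ : _ = 0%R) ?addr0.
  apply: eq_bigr => j _; rewrite !mul_diag_mx !mxE /all_but_last.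
  rewrite (_ : widen_ord (leq_pred m.+1) j = widen_ord (leqnSn m) j); last first.
    exact: val_inj.
  rewrite (_ : lift ord_max j = widen_ord (leqnSn m) j); last first.
    by apply/val_inj; rewrite /= /bump leqNgt ltn_ord.
  by rewrite /= eqSS ltn_eqF.
by rewrite !mul_diag_mx !mxE /= eqxx mul0r mulr0.
Qed.

(** Adding the bound [M] makes the test function nonnegative, so that the integrals can be handled
    by Tonelli and by the lemmas for nonnegative functions. *)
Lemma expectation_shift d (T : measurableType d) (P : probability T R)
    (g : T -> R) (M : R) :
  measurable_fun setT g -> (forall x, `|g x| <= M)%R ->
  'E_P[g] = \int[P]_x (g x + M)%:E - M%:E.
Proof.
move=> mg gM.
have ig : P.-integrable setT (EFin \o g).
  apply: (@le_integrable _ _ _ P setT measurableT _ (cst M%:E)) => //.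
  - exact/measurable_EFinP.
  - by move=> x _ /=; rewrite lee_fin (le_trans (gM x))// ler_norm.
  - exact: finite_measure_integrable_cst.
have iM : P.-integrable setT (EFin \o cst M).
  exact: finite_measure_integrable_cst.
rewrite unlock [in RHS](eq_integral (fun x => (g x)%:E + (cst M x)%:E)); last first.
  by move=> x _; rewrite EFinD.
rewrite integralD_EFin// [X in _ + X - _](_ : _ = M%:E) ?addeK//.
by have := integral_cst P measurableT M%:E; rewrite /= probability_setT mule1.
Qed.

Section smoothing.
Variables (f : 'cV[R]_p -> R) (M : R) (c : 'cV[R]_p).
Variables (m : nat) (L : 'M[R]_(p, m)).
Variables (d : measure_display) (T : measurableType d) (Q : probability T R).
Variable (eps : {RV Q >-> 'cV[R]_p}).
Hypotheses (fc : continuous f) (f0 : forall x, (0 <= f x)%R).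
Hypothesis fM : forall x, (f x <= M)%R.

(** The function h of the overview. Boundedness of [f] makes the integral finite, so [fine] loses
    nothing. *)
Definition smoothed (w : 'cV[R]_m) : R :=
  fine (\int[distribution Q eps]_e (f (c + L *m w + e)%R)%:E).

Let mF : measurable_fun setT
  (fun we : 'cV[R]_m * 'cV[R]_p => f (c + L *m we.1 + we.2)%R).
Proof.
exact: (measurableT_comp (continuous_measurable_fun_mx fc) (measurable_affine _ _)).
Qed.

Let mFw w : measurable_fun setT (fun e => f (c + L *m w + e)%R).
Proof. exact: (measurableT_comp mF (pair1_measurable w)). Qed.

Let intF w : \int[distribution Q eps]_e (f (c + L *m w + e)%R)%:E \is a fin_num.
Proof. exact: (@ge0_bounded_integral_fin_num _ _ _ (distribution Q eps) _ M). Qed.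

Lemma smoothedE w :
  (smoothed w)%:E = \int[distribution Q eps]_e (f (c + L *m w + e)%R)%:E.
Proof. by rewrite fineK. Qed.

Lemma smoothed_ge0 w : (0 <= smoothed w)%R.
Proof. by apply: fine_ge0; apply: integral_ge0 => e _; rewrite lee_fin. Qed.

Lemma smoothed_le w : (smoothed w <= M)%R.
Proof.
rewrite -lee_fin smoothedE -[leRHS]mule1.
rewrite -(integral_probability_cst1 (distribution Q eps)) -ge0_integralZl//.
  apply: ge0_le_integral => //.
  - by move=> e _; rewrite lee_fin.
  - exact/measurable_EFinP.
  - by move=> e _; rewrite mule1 lee_fin.
by rewrite lee_fin (le_trans (f0 0%R)).
Qed.

Lemma measurable_smoothed : measurable_fun setT smoothed.
Proof.
apply: (measurableT_comp (fine_measurable measurableT)).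
apply: (measurable_fun_fubini_tonelli_F (m2 := distribution Q eps)
  (fun we => (f (c + L *m we.1 + we.2)%R)%:E)).
  exact/measurable_EFinP.
by move=> z; rewrite lee_fin.
Qed.

Lemma smoothed_continuous w : continuous (fun a : R => smoothed (a *: w)%R).
Proof.
move=> a.
(* Continuity under the integral is applied on an interval of parameters around [a], with the
   constant [M] as dominating function. *)
have aI : a \in (`](a - 1)%R, (a + 1)%R[%classic : set R).
  by rewrite mem_set//= in_itv/= ltrBlDr ltrDl ltr01.
apply: (@continuity_under_integral R _ _ (distribution Q eps)
  (fun b e => f (c + L *m (b *: w) + e)%R) setT measurableT (a - 1)%R (a + 1)%R
  _ _ (cst M) _ _ a aI).
- move=> b _.
  apply: (@le_integrable _ _ _ (distribution Q eps) setT measurableT _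
    (cst M%:E)) => //.
  + exact/measurable_EFinP.
  + move=> e _ /=; rewrite lee_fin ger0_norm// ger0_norm//.
    exact: le_trans (f0 0%R) (fM _).
  + exact: finite_measure_integrable_cst.
- apply: aeW => e _ b _.
  apply: (@cvg_comp _ _ _ (fun b : R => c + L *m (b *: w) + e)%R f _
    (nbhs (c + L *m (b *: w) + e)%R)); last exact: fc.
  apply: cvgD; last exact: cvg_cst.
  apply: cvgD; first exact: cvg_cst.
  rewrite (_ : (fun b : R => L *m (b *: w)) = (fun b : R => b *: (L *m w)))%R.
    by rewrite -scalemxAr; apply: cvgZr_tmp; exact: cvg_id.
  by apply/funext => b'; rewrite scalemxAr.
- exact: finite_measure_integrable_cst.
- by move=> b _; apply: aeW => e _; rewrite ger0_norm.
Qed.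

End smoothing.

End factor_model.

Section factor_model_limit.
Context {R : realType}.
Local Open Scope ereal_scope.

Lemma integral_factor_model p k (A : 'M[R]_(p, k)) (c : 'cV[R]_p)
    (f : 'cV[R]_p -> R) (M : R) d (T : measurableType d) (P : probability T R)
    (eta : {RV P >-> 'cV[R]_k}) (eps : {RV P >-> 'cV[R]_p}) :
  continuous f -> (forall x, 0 <= f x)%R -> (forall x, f x <= M)%R ->
  independent_RVs eta eps ->
  \int[P]_w (f (c + A *m eta w + eps w)%R)%:E =
  \int[distribution P eta]_z (smoothed f c A eps z)%:E.
Proof.
move=> fc f0 fM ind.
rewrite (ge0_integral_independent
  (F := fun ze => (f (c + A *m ze.1 + ze.2)%R)%:E) ind)/=.
- by apply: eq_integral => z _; rewrite (smoothedE _ _ _ fc f0 fM).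
- apply/measurable_EFinP.
  exact: (measurableT_comp (continuous_measurable_fun_mx fc)
    (measurable_affine _ _)).
- by move=> z; rewrite lee_fin.
Qed.

End factor_model_limit.

(** * Convergence of the factor models as tau grows *)

Unset Implicit Arguments.

Theorem proposition4 (R : realType) (k p : nat) (hk : (1 <= k <= p)%N)
  (u : 'I_k -> 'cV[R]_p)
  (u_orthonormal : forall i j, dotv (u i) (u j) = (i == j)%:R)
  (s : 'I_k -> R)
  (s_ge0 : forall i, 0 <= s i)
  (s_decr : forall i j : 'I_k, (i <= j)%N -> s j <= s i)
  (c : 'cV[R]_p) (sigma : 'I_p -> R) (sigma_gt0 : forall i, 0 < sigma i)
  (Sigma : 'M[R]_p) (SigmaE : Sigma = diag_mx (\row_(i < p) sigma i ^+ 2))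
  (* the prelimit model, one probability space for each tau > 0 *)
  (d : R -> measure_display) (T : forall tau, measurableType (d tau))
  (P : forall tau, probability (T tau) R)
  (eta : forall tau, {RV (P tau) >-> 'cV[R]_k})
  (eps : forall tau, {RV (P tau) >-> 'cV[R]_p})
  (eta_law : forall tau, 0 < tau ->
     has_law (eta tau) (vMF (last_basis_vector k) tau))
  (eps_law : forall tau, 0 < tau -> has_law (eps tau) (mvnormal 0 Sigma))
  (eta_eps_indep : forall tau, 0 < tau ->
     independent_RVs (eta tau) (eps tau))
  (* the limit model *)
  (d' : measure_display) (T' : measurableType d') (Q : probability T' R)
  (eta' : {RV Q >-> 'cV[R]_k.-1}) (eps' : {RV Q >-> 'cV[R]_p})
  (eta'_law : has_law eta' (mvnormal 0 1%:M))
  (eps'_law : has_law eps' (mvnormal 0 Sigma))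
  (eta'_eps'_indep : independent_RVs eta' eps') :
  cvg_in_distribution P
    (fun tau w => c + Lambda_tau u s tau *m eta tau w + eps tau w)
    Q
    (fun w => c + Lambda_tilde u s *m eta' w + eps' w).
Proof.
(* Writing k = m + 1 makes [k.-1] compute to [m]; k = 0 contradicts 1 <= k. *)
case: k hk u u_orthonormal s s_ge0 s_decr eta eta_law eta_eps_indep eta'
  eta'_law eta'_eps'_indep => [//|m] _ u _ s _ _ eta eta_law eta_eps_indep eta'
  eta'_law eta'_eps'_indep.
move=> f fc [M fM].
pose g x := f x + M.
have gc : continuous g.
  by move=> x; exact: (cvgD (fc x) (cvg_cst M)).
have g0 x : 0 <= g x.
  by rewrite -lerBlDr sub0r; have := fM x; rewrite ler_norml => /andP[].
have gM x : g x <= M + M.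
  by rewrite lerD2r; exact: le_trans (ler_norm _) (fM x).
have mf := continuous_measurable_fun_mx fc.
have mX t : measurable_fun setT
    (f \o (fun w => c + Lambda_tau u s t *m eta t w + eps t w)).
  apply: (measurableT_comp mf).
  apply: (measurableT_comp (measurable_affine (Lambda_tau u s t) c)
    (g := fun w => (eta t w, eps t w))).
  by apply: measurable_fun_pair; exact: measurable_funPT.
have mY : measurable_fun setT
    (f \o (fun w => c + Lambda_tilde u s *m eta' w + eps' w)).
  apply: (measurableT_comp mf).
  apply: (measurableT_comp (measurable_affine (Lambda_tilde u s) c)
    (g := fun w => (eta' w, eps' w))).
  by apply: measurable_fun_pair; exact: measurable_funPT.
rewrite (expectation_shift Q mY (fun _ => fM _)).
under eq_cvg do rewrite (expectation_shift (P _) (mX _) (fun _ => fM _)).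
pose h := smoothed g c (Lambda_tilde u s) eps'.
rewrite (integral_factor_model _ _ gc g0 gM eta'_eps'_indep) -/h.
(* The noise has the same law in every model, so a single smoothed function [h] serves for all [t] >
   0 and for the limit. *)
have smoothE t z : 0 < t ->
    smoothed g c (Lambda_tau u s t) (eps t) z = h (Num.sqrt t *: initV z).
  move=> t0; rewrite /h /smoothed Lambda_tau_mul.
  by rewrite (eq_integral_law _ (eps_law t t0) eps'_law).
apply: cvgeB; [exact: fin_num_adde_defl| |exact: cvg_cst].
(* Dominated convergence is about sequences, so the limit along the reals is tested on sequences
   tending to infinity. *)
apply/cvge_pinftyP => w woo.
(* The laws are prescribed only for positive parameters; [v] is positive for every n and eventually
   equals [w]. *)
pose v n := Num.max (w n) 1.
have v0 n : 0 < v n by rewrite lt_max ltr01 orbT.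
have w1 : \forall n \near \oo, w n = v n.
  have /cvgryPge/(_ 1) := woo.
  by apply: filterS => n wn; rewrite /v max_l.
have voo : v n @[n --> \oo] --> +oo.
  by apply: cvg_trans woo; apply: near_eq_cvg.
have mh : measurable_fun setT h by exact: measurable_smoothed.
have h0 y : 0 <= h y by exact: smoothed_ge0.
have hM y : h y <= M + M by exact: smoothed_le.
have hc y : continuous (fun a : R => h (a *: y)).
  by apply: smoothed_continuous gc g0 gM _.
have := vMF_cvg_gauss mh h0 hM hc v0 voo (fun n => eta_law (v n) (v0 n)) eta'_law.
apply: cvg_trans; apply: near_eq_cvg.
apply: filterS w1 => n ->.
rewrite (integral_factor_model _ _ gc g0 gM (eta_eps_indep _ (v0 n))).
by apply: eq_integral => z _; rewrite smoothE.
Qed.
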